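(* Let $\mathcal{A}_1,\dots,\mathcal{A}_n$ be finite labelled transition systems, $\mathbf{A}=\mathcal{A}_1\parallel\cdots\parallel\mathcal{A}_n$, with interface $\mathcal{A}_i$ (no non-divergence assumption). Every run of Algorithm 2 (for every choice of the order in which possible extensions are added) terminates and returns a finite branching process $\mathcal{N}$ of $\mathbf{A}$ such that the folding $\mathcal{S}_i$ of the interface projection $\mathcal{N}_i$ satisfies $\mathrm{Tr}(\mathcal{S}_i)=\mathrm{Tr}(\mathbf{A})|_{\Sigma_i}$, i.e. $\mathcal{S}_i$ is a summary of $\mathbf{A}$.
   Context: A labelled transition system (LTS) is $\mathcal{A}=(\Sigma,S,T,\lambda,s^0)$ with finite actions, finite states, $T\subseteq S\times S$, $\lambda:T\to\Sigma$, initial state $s^0$. An execution is a finite or infinite sequence $t_1t_2\dots$ of transitions with $t_k=(s_{k-1},s_k)$; a history is one with $s_0=s^0$; a trace is the label sequence of a history; $\mathrm{Tr}(\mathcal{A})$ is the set of (finite and infinite) traces. For $\mathcal{A}_j=(\Sigma_j,S_j,T_j,\lambda_j,s^0_j)$, $\mathbf{A}=\mathcal{A}_1\parallel\cdots\parallel\mathcal{A}_n$ has actions $\bigcup_j\Sigma_j$, global states in $S_1\times\cdots\times S_n$, initial state $(s^0_1,\dots,s^0_n)$, and global transitions $\mathbf{t}=(t_1,\dots,t_n)\ne(\star,\dots,\star)$ with label $a$ where $t_j$ is an $a$-transition of $\mathcal{A}_j$ if $a\in\Sigma_j$ and $t_j=\star$ otherwise ($\mathcal{A}_j$ moves along $t_j$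 if $t_j\ne\star$, else stays; it participates iff $t_j\neq\star$). ${}^\bullet\mathbf{t}$ / $\mathbf{t}^\bullet$ are the source / target states of the $t_j\ne\star$. $X|_{\Sigma_i}$ denotes projections of traces in $X$ onto $\Sigma_i$. Branching processes: Petri nets with conditions labelled by local states and events labelled by global transitions (hence actions), defined inductively: the net with conditions $b^0_1,\dots,b^0_n$ labelled $s^0_1,\dots,s^0_n$, no events, initial marking $\{b^0_1,\dots,b^0_n\}$ is one; if a reachable marking of $\mathcal{N}$ contains a set $M$ of conditions labelled exactly by ${}^\bullet\mathbf{t}$ and no event labelled $\mathbf{t}$ has input set $M$, then adding an event $e$ labelled $\mathbf{t}$ with inputs $M$ and a fresh output condition labelled $s$ for each $s\in\mathbf{t}^\bullet$ yields a branching process ($e$ is a possible extension of $\mathcal{N}$). $x<y$: nonempty arc path from $x$ to $y$. Conflict: some condition $z\ne x,y$ from which both are reachable leaving $z$ by different arcs. Concurrent: neither causally related ($\le$ either way) nor in conflict. $[e]=\{e':e'\le e\}$; $M(e)$: marking reached by firing exactly $[e]$; $M(e)_j$: its condition labelled by a state of $\mathcal{A}_j$; $\mathrm{St}(e)$: the global state of labels of $M(e)$. An $i$-event is one in which $\mathcal{A}_i$ participates; $ip(e)=M(e)_i$. Strong cause: $e'\ll e$ iff $e'<e$ and $b'<b$ for all $b\in M(e)\setminus M(e')$, $b'\in M(e')\setminus M(e)$. Cut-offs and candidates (relative to the current process $\mathcal{N}$, for a new event $e$): $\mathrm{Con}_i(\mathcal{N},e)$ is the set of $i$-events of $\mathcal{N}$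 that are not cut-offs and are concurrent with $e$. $e$ is a cut-off if it is an $i$-event and $\mathcal{N}$ contains an $i$-event $e'$ with $\mathrm{St}(e)=\mathrm{St}(e')$ ($e'$ is a companion). $e$ is a cut-off candidate of $\mathcal{N}$ if it is not an $i$-event and $\mathcal{N}$ contains $e'\ll e$ with $\mathrm{St}(e)=\mathrm{St}(e')$, $ip(e')=ip(e)$ and $\mathrm{Con}_i(\mathcal{N},e)\subseteq\mathrm{Con}_i(\mathcal{N},e')$. An event $e$ frees a cut-off candidate $e_c$ of $\mathcal{N}$ if $e_c$ is not a cut-off candidate of the branching process obtained by adding $e$ to $\mathcal{N}$. Algorithm 2: start with the branching process without events, $co=coc=\emptyset$. While there is a possible extension of $\mathcal{N}$ with no event of $co\cup coc$ in its causal past, choose any such $e$; if $e$ is a cut-off, add it to $co$; else if $e$ is a cut-off candidate of $\mathcal{N}$, add it to $coc$; else remove from $coc$ every $e'\in coc$ that $e$ frees; then add $e$ to $\mathcal{N}$. At termination, let $\equiv$ be the smallest equivalence on conditions labelled by states of $\mathcal{A}_i$ with $M(e)_i\equiv M(e')_i$ for every $e\in co$ with companion $e'$. Interface projection $\mathcal{N}_i$: LTS whose states are the conditions labelled by states of $\mathcal{A}_i$, initial state $b^0_i$, with a transition $(b,b')$ labelled $a$ for each $i$-event with action $a$, input $i$-condition $b$ and output $i$-condition $b'$. Its folding $\mathcal{S}_i$: states $[b]_\equiv$, initial state $[b^0_i]_\equiv$, a transition $([b]_\equiv,[b']_\equiv)$ labelled $a$ for each such transition of $\mathcal{N}_i$.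 *)

(* Defs.v *)
From mathcomp Require Import all_boot.
From Stdlib Require Import Relations.
Set Implicit Arguments. Unset Strict Implicit. Unset Printing Implicit Defensive.

(* T ⊆ S × S together with λ : T → Σ is encoded as ltr : S -> S -> option Act
   (ltr s s' = Some a  iff  (s,s') ∈ T and λ(s,s') = a).                 *)
Record LTS (Act : finType) := {
  lst   : finType;
  lsig  : {set Act};
  ltr   : lst -> lst -> option Act;
  linit : lst;
  lwf   : forall s s' a, ltr s s' = Some a -> a \in lsig }.

Inductive word (Act : Type) := WFin of seq Act | WInf of (nat -> Act).

Section Traces.
Variables (Act : Type) (State : Type) (step : State -> Act -> State -> Prop).

Fixpoint fin_run (s : State) (w : seq Act) : Prop :=
  match w with
  | [::] => True
  | a :: w' => exists s', step s a s' /\ fin_run s' w'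
  end.

Definition is_trace (s0 : State) (w : word Act) : Prop :=
  match w with
  | WFin u => fin_run s0 u
  | WInf f => exists rho : nat -> State,
      rho 0 = s0 /\ forall k, step (rho k) (f k) (rho k.+1)
  end.
End Traces.

Definition proj (Act : finType) (Sig : {set Act}) (u w : word Act) : Prop :=
  match u with
  | WFin s => w = WFin [seq a <- s | a \in Sig]
  | WInf f =>
      (exists N, (forall k, N <= k -> f k \notin Sig) /\
                 w = WFin [seq a <- mkseq f N | a \in Sig])
   \/ (exists (phi : nat -> nat) (g : nat -> Act),
         w = WInf g /\ (forall k, phi k < phi k.+1) /\
         (forall m, f m \in Sig <-> exists k, phi k = m) /\
         (forall k, g k = f (phi k)))
  end.

Section Product.
Variables (Act : finType) (n : nat) (A : 'I_n -> LTS Act).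

Definition gstate := forall j, lst (A j).
Definition ginit : gstate := fun j => linit (A j).

Definition ltrans := forall j, option (lst (A j) * lst (A j)).

Definition gtrans (a : Act) (f : ltrans) : Prop :=
  (forall j, isSome (f j) = (a \in lsig (A j))) /\
  (forall j p, f j = Some p -> ltr p.1 p.2 = Some a) /\
  (exists j, a \in lsig (A j)).

Definition gstep (g : gstate) (a : Act) (g' : gstate) : Prop :=
  exists f : ltrans, gtrans a f /\
    forall j, match f j with
              | None => g' j = g j
              | Some p => g j = p.1 /\ g' j = p.2
              end.

(* An event: its label (a global transition (a, f)) and, for each
   participating component j, its input j-condition. *)
Record Event := { ev_act : Act; ev_tr : ltrans; ev_in : 'I_n -> option nat }.

(* A condition of component j is (None, j) = b^0_j, or (Some k, j) = the
   output j-condition of the k-th event. *)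
Definition cond := (option nat * 'I_n)%type.

(* A branching process is represented by the list of its events, in
   the order in which they were added. *)
Definition participates (P : seq Event) (k : nat) (j : 'I_n) : bool :=
  if onth P k is Some e then isSome (ev_tr e j) else false.

Definition valid_cond (P : seq Event) (c : cond) : Prop :=
  c.1 = None \/ exists k, c.1 = Some k /\ participates P k c.2.

Definition condlab (P : seq Event) (c : cond) : lst (A c.2) :=
  match c.1 with
  | None => linit (A c.2)
  | Some k =>
      match onth P k with
      | Some e => match ev_tr e c.2 with Some p => p.2 | None => linit (A c.2) end
      | None => linit (A c.2)
      end
  end.

Definition preb (e : Event) (c : cond) : bool :=
  isSome (ev_tr e c.2) && (ev_in e c.2 == c.1).
Definition postb (k : nat) (e : Event) (c : cond) : bool :=
  (c.1 == Some k) && isSome (ev_tr e c.2).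

Inductive Reach (P : seq Event) : (cond -> Prop) -> Prop :=
  | Reach0 : Reach P (fun c => c.1 = None)
  | ReachS M k e : Reach P M -> onth P k = Some e ->
      (forall c, preb e c -> M c) ->
      Reach P (fun c => (M c /\ ~~ preb e c) \/ postb k e c).

Definition poss_ext (P : seq Event) (e : Event) : Prop :=
  gtrans (ev_act e) (ev_tr e) /\
  (forall j p, ev_tr e j = Some p ->
     valid_cond P (ev_in e j, j) /\ condlab P (ev_in e j, j) = p.1) /\
  (exists M, Reach P M /\ forall j, isSome (ev_tr e j) -> M (ev_in e j, j)) /\
  ~ (exists k e', onth P k = Some e' /\ ev_act e' = ev_act e /\
       (forall j, ev_tr e' j = ev_tr e j) /\
       (forall j, isSome (ev_tr e j) -> ev_in e' j = ev_in e j)).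

Inductive bp : seq Event -> Prop :=
  | bp0 : bp [::]
  | bpS P e : bp P -> poss_ext P e -> bp (rcons P e).

Inductive node := NE of nat | NC of cond.

Definition inpre (P : seq Event) (k : nat) (c : cond) : Prop :=
  exists e, onth P k = Some e /\ preb e c.
Definition outpost (P : seq Event) (k : nat) (c : cond) : Prop :=
  c.1 = Some k /\ participates P k c.2.

Definition flow (P : seq Event) (x y : node) : Prop :=
  match x, y with
  | NC c, NE k => inpre P k c
  | NE k, NC c => outpost P k c
  | _, _ => False
  end.

Definition lt_n (P : seq Event) := clos_trans node (flow P).
Definition le_n (P : seq Event) (x y : node) := x = y \/ lt_n P x y.

Definition conflict (P : seq Event) (x y : node) : Prop :=
  exists c k1 k2, k1 <> k2 /\ flow P (NC c) (NE k1) /\ flow P (NC c) (NE k2) /\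
    le_n P (NE k1) x /\ le_n P (NE k2) y.

Definition concurrent (P : seq Event) (x y : node) : Prop :=
  ~ le_n P x y /\ ~ le_n P y x /\ ~ conflict P x y.

(* M(e): the marking reached by firing exactly [e] *)
Definition Mark (P : seq Event) (k : nat) (c : cond) : Prop :=
  (c.1 = None \/ exists k', c.1 = Some k' /\ outpost P k' c /\ le_n P (NE k') (NE k)) /\
  ~ (exists k', le_n P (NE k') (NE k) /\ inpre P k' c).

Definition sameSt (P : seq Event) (k k' : nat) : Prop :=
  forall j o o', Mark P k (o, j) -> Mark P k' (o', j) ->
    condlab P (o, j) = condlab P (o', j).

Definition strong (P : seq Event) (k' k : nat) : Prop :=
  lt_n P (NE k') (NE k) /\
  forall b b', Mark P k b -> ~ Mark P k' b -> Mark P k' b' -> ~ Mark P k b' ->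
    lt_n P (NC b') (NC b).

Section Interface.
Variable i : 'I_n.

Definition sameIp (P : seq Event) (k k' : nat) : Prop :=
  forall o, Mark P k (o, i) <-> Mark P k' (o, i).

Definition companion (P : seq Event) (k k' : nat) : Prop :=
  k' < k /\ participates P k' i /\ sameSt P k k'.

Definition cutoff (P : seq Event) (k : nat) : Prop :=
  participates P k i /\ exists k', companion P k k'.

(* Con_i(P, e); co = set of cut-offs determined so far *)
Definition Con (co : nat -> Prop) (P : seq Event) (k x : nat) : Prop :=
  x < size P /\ participates P x i /\ ~ co x /\ concurrent P (NE x) (NE k).

Definition candidate (co : nat -> Prop) (P : seq Event) (k : nat) : Prop :=
  ~~ participates P k i /\
  exists k', k' < size P /\ strong P k' k /\ sameSt P k k' /\ sameIp P k k' /\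
    (forall x, Con co P k x -> Con co P k' x).

Definition astate := (seq Event * (nat -> Prop) * (nat -> Prop))%type.
Definition ainit : astate := ([::], fun _ => False, fun _ => False).

Definition eligible (s : astate) (e : Event) : Prop :=
  let: (N, co, coc) := s in
  poss_ext N e /\
  ~ (exists k, (co k \/ coc k) /\ le_n (rcons N e) (NE k) (NE (size N))).

Definition astep (s s' : astate) : Prop :=
  let: (N, co, coc) := s in
  exists e, eligible s e /\
    let P := rcons N e in let x := size N in
    [\/ cutoff P x /\ s' = (P, fun k => co k \/ k = x, coc),
        ~ cutoff P x /\ candidate co P x /\ s' = (P, co, fun k => coc k \/ k = x)
      | ~ cutoff P x /\ ~ candidate co P x /\
        s' = (P, co, fun k => coc k /\ ~ (candidate co N k /\ ~ candidate co P k))].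

Definition terminal (s : astate) : Prop := ~ exists e, eligible s e.

Definition fold_gen (P : seq Event) (co : nat -> Prop) (b b' : cond) : Prop :=
  exists k k', co k /\ companion P k k' /\
    Mark P k b /\ b.2 = i /\ Mark P k' b' /\ b'.2 = i.

Definition fold_eq (P : seq Event) (co : nat -> Prop) :=
  clos_refl_sym_trans cond (fold_gen P co).

Definition istep (P : seq Event) (b : cond) (a : Act) (b' : cond) : Prop :=
  exists k e, onth P k = Some e /\ ev_act e = a /\ isSome (ev_tr e i) /\
    b = (ev_in e i, i) /\ b' = (Some k, i).

(* transitions of the folding S_i, with each state [b]_≡ represented by
   any of its members b *)
Definition fstep (P : seq Event) (co : nat -> Prop) (b : cond) (a : Act) (b' : cond) :=
  exists c c', istep P c a c' /\ fold_eq P co b c /\ fold_eq P co b' c'.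

Definition fold_init : cond := (None, i).

End Interface.
End Product.

(* Main.v *)
Require Import Defs.
From mathcomp Require Import all_boot zify.
From mathcomp Require Import boolp.
From Stdlib Require Import Relations.
Set Implicit Arguments. Unset Strict Implicit. Unset Printing Implicit Defensive.

(** Events are numbered in the order in which they are added; a process is then
    a partial map [E] from indices to events, and causality increases indices.

    Traces of S_i are traces of A: equivalent i-conditions are reached by local
    configurations with the same global state, and the events of [e] above those
    of the preceding i-event form an execution whose only visible label is the
    last one.

    Conversely, a finite history is replayed inside the final process from the
    configuration of the last i-event e0.  A cut-off is replaced by its
    companion.  A candidate e with strong cause e' is skipped: the condition on
    Con_i makes e0 compatible with e', and e' << e forces [e] \ [e'] to be
    disjoint from [e0], so that [e] u [e0] and [e'] u [e0] lead to the same
    global state; the history gets shorter.  Infinite traces follow by Koenig's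
    lemma.

    An infinite run would contain an infinite causal chain c.  Non-cut-off
    i-events have distinct global states, hence are finitely many, so Con_i
    along c is eventually decreasing and ip eventually constant.  Since all but
    finitely many events below the chain are above any given c k, we get
    c k << c l for l large; with equal global states, c l would be a candidate
    forever, contradicting that c (l+1) was added. *)

(** * Configurations, cuts and local configurations *)

Section Growth.
Variables (Act : finType) (n : nat) (A : 'I_n -> LTS Act).
Variable E : nat -> option (Event A).
Implicit Types (C D : pred nat) (P : seq (Event A)) (j : 'I_n) (k x y z : nat).

Definition agree (P : seq (Event A)) := forall x, x < size P -> onth P x = E x.

(** Each event is a possible extension of the process formed by the earlier ones. The prefix form
    covers both a finite process and the limit of an infinite run. *)
Definition grow := forall k e, E k = Some e ->
  exists P, [/\ bp P, size P = k, agree P & poss_ext P e].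

Definition part k j := if E k is Some e then isSome (ev_tr e j) else false.
Definition inn k j := if E k is Some e then ev_in e j else None.
Definition lab (o : option nat) (j : 'I_n) : lst (A j) :=
  match o with
  | None => linit (A j)
  | Some k =>
      match E k with
      | Some e => match ev_tr e j with Some p => p.2 | None => linit (A j) end
      | None => linit (A j)
      end
  end.
Definition dep x y := exists j, part y j /\ inn y j = Some x.
Definition cle := clos_refl_trans nat dep.

(* The last j-event of C below m; for a configuration C below m, the j-condition
   of its cut is (top m C j, j). *)
Fixpoint top m (C : pred nat) j : option nat :=
  if m is m'.+1 then
    if C m' && part m' j then Some m' else top m' C j
  else None.

Definition istop m (C : pred nat) j o :=
  match o with
  | None => forall y, y < m -> C y -> part y j -> False
  | Some x => [/\ x < m, C x, part x j &
                  forall y, y < m -> C y -> part y j -> y <= x]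
  end.

Lemma topP m C j : istop m C j (top m C j).
Proof.
elim: m => [|m IH] //=; case: ifP => [/andP[Cm pm]|H] /=; first by split.
case: (top m C j) IH => [x|] /=.
  move=> [xm Cx px H2]; split=> //; first by lia.
  move=> y; rewrite ltnS leq_eqVlt => /orP[/eqP-> Cm pm|]; last by auto.
  by rewrite Cm pm in H.
move=> H2 y; rewrite ltnS leq_eqVlt => /orP[/eqP-> Cm pm|]; last by eauto.
by rewrite Cm pm in H.
Qed.

(** The usual way to compute [top]: exhibit some [o] satisfying [istop]. *)
Lemma istop_uniq m C j o : istop m C j o -> top m C j = o.
Proof.
have := topP m C j; case: (top m C j) => [x|]; case: o => [y|] //=.
- by move=> [? ? ? H1] [? ? ? H2]; congr Some; apply/eqP; rewrite eqn_leq H1 // H2.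
- by move=> [? ? ? _] H; case: (H x).
- by move=> H [? ? ? _]; case: (H y).
Qed.

Lemma top_max m C j y : y < m -> C y -> part y j ->
  exists2 x, top m C j = Some x & y <= x.
Proof.
move=> ym Cy py; have := topP m C j; case: (top m C j) => [x|] /=.
  by move=> [_ _ _ H]; exists x => //; apply: H.
by move=> H; case: (H y).
Qed.

Lemma topS m C j x : top m C j = Some x -> [/\ x < m, C x & part x j].
Proof. by move=> H; have := topP m C j; rewrite H => -[]. Qed.

Lemma top_ext m C D j : (forall y, y < m -> part y j -> C y = D y) ->
  top m C j = top m D j.
Proof.
elim: m => //= m IH H; rewrite IH => [|y ym]; last by apply: H; lia.
by case: (boolP (part m j)) => pm; rewrite ?andbF ?andbT // H.
Qed.

Lemma top_bound m m' C j :
  (forall y, C y -> part y j -> y < m) -> (forall y, C y -> part y j -> y < m') ->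
  top m C j = top m' C j.
Proof.
move=> H H'; apply: istop_uniq; have := topP m' C j.
case: (top m' C j) => [x|] /=; last by move=> T y _ Cy py; apply: (T y) => //; auto.
by move=> [? ? ? T]; split; auto.
Qed.

(* Each event of C consumes the output of the preceding j-event of C: this says
   at once that C is causally closed and conflict-free. *)
Definition cfg (C : pred nat) := forall x, C x ->
  isSome (E x) /\ forall j, part x j -> inn x j = top x C j.

Lemma cfg_dc C x y : cfg C -> C y -> dep x y -> C x.
Proof.
move=> cC Cy [j [pj iy]]; have [_ /(_ _ pj)] := cC _ Cy.
by rewrite iy => /esym/topS[].
Qed.

Lemma cfg_le C x y : cfg C -> C y -> cle x y -> C x.
Proof. by move=> cC Cy xy; elim: xy Cy => //; eauto using cfg_dc. Qed.

(** Strong induction on [y], which consumes the output of the last [j]-event before it; that event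
    is [x] or a later one. *)
Lemma cfg_line C j x y : cfg C -> C x -> C y -> part x j -> part y j ->
  x <= y -> cle x y.
Proof.
move=> cC Cx; have [m] := ubnP y; elim: m y => // m IH y ym Cy px py.
rewrite leq_eqVlt => /orP[/eqP->|xy]; first exact: rt_refl.
have [_ /(_ _ py)] := cC _ Cy; have [z -> xz iy] := top_max xy Cx px.
have [zy Cz pz] : [/\ z < y, C z & part z j].
  by apply: topS; have [_ /(_ _ py)] := cC _ Cy; rewrite iy => <-.
apply: rt_trans (IH z _ Cz px pz xz) _; first by lia.
by apply: rt_step; exists j.
Qed.

(** The last [j]-event of [C] before [x] is a cause of [x], so causal closure keeps it in [D], where
    it is still the last one. *)
Lemma cfg_sub C D : cfg C -> (forall x, D x -> C x) ->
  (forall x y, D y -> dep x y -> D x) -> cfg D.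
Proof.
move=> cC DC dcD x Dx; have [Ex H] := cC _ (DC _ Dx); split=> // j pj.
rewrite (H _ pj); apply/esym/istop_uniq; have := topP x C j.
case Et: (top x C j) => [y|] /= T; last by move=> y yx /DC; apply: T.
have Dy : D y by apply: (dcD y x) => //; exists j; rewrite (H _ pj).
by case: T => ? ? ? T; split=> // z zx /DC; apply: T.
Qed.

(** No [j]-event of [D] comes after [x]: by [cfg_line] it would have [x] as a cause, and [x] would
    lie in [D]. So the producer of the input of [x], assumed in [D], is the last [j]-event of
    [D]. *)
Lemma cfg_next C (D : pred nat) N x j : cfg C -> (forall y, D y -> C y) ->
  (forall y z, D z -> dep y z -> D y) -> C x -> ~~ D x -> part x j ->
  (forall y, inn x j = Some y -> D y) -> (forall y, D y -> y < N) ->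
  inn x j = top N D j.
Proof.
move=> cC DC dcD Cx nDx px iD bD; have [_ /(_ _ px) ix] := cC _ Cx.
have cD := cfg_sub cC DC dcD.
have lx y : D y -> part y j -> y < x.
  move=> Dy py; rewrite ltnNge; apply: contra nDx => xy.
  exact: cfg_le cD Dy (cfg_line cC Cx (DC _ Dy) px py xy).
apply/esym/istop_uniq; have := topP x C j; rewrite -ix.
case Ei: (inn x j) => [y|] /=; last by move=> T z _ Dz pz; apply: (T z); auto.
move=> [yx Cy py T]; split; auto.
Qed.

Definition addc (C : pred nat) k : pred nat := fun x => (x == k) || C x.

Hypothesis gE : grow.

Lemma inn_lt k j x : part k j -> inn k j = Some x -> x < k /\ part x j.
Proof.
rewrite /part /inn; case Ek: (E k) => [e|//] pj ej.
have [P [_ sP aP [_ [H _]]]] := gE Ek.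
case Etr: (ev_tr e j) pj => [p|//] _.
have [[/= H1|[k' [/= H1 H2]]] _] := H _ _ Etr; first by rewrite ej in H1.
move: H1; rewrite ej => -[?]; subst k'.
move: H2; rewrite /participates /part.
have [lx|ge] := ltnP x (size P); last by rewrite onth_default.
by rewrite aP // -sP.
Qed.

Lemma dep_lt x y : dep x y -> x < y.
Proof. by case=> j [p i]; case: (inn_lt p i). Qed.

Lemma cle_leq x y : cle x y -> x <= y.
Proof. by elim=> // [u v /dep_lt/ltnW //|u v w _ uv _ vw]; apply: leq_trans uv vw. Qed.

Lemma cle_trans y x z : cle x y -> cle y z -> cle x z.
Proof. exact: rt_trans. Qed.

Lemma cle_refl x : cle x x. Proof. exact: rt_refl. Qed.

Lemma cle_dep x y : dep x y -> cle x y. Proof. exact: rt_step. Qed.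

Lemma cle_anti x y : cle x y -> cle y x -> x = y.
Proof. by move=> /cle_leq xy /cle_leq yx; apply/eqP; rewrite eqn_leq xy. Qed.

Lemma cle_invl x y : cle x y -> x = y \/ exists2 z, dep x z & cle z y.
Proof.
move=> H0; have H := clos_rt_rt1n _ _ _ _ H0; destruct H as [|z w xz zw]; first by left.
by right; exists z => //; apply: (clos_rt1n_rt _ _ _ _ zw).
Qed.

Lemma cle_cross (Q : nat -> Prop) x y : cle x y -> ~ Q x -> Q y ->
  exists u v, [/\ cle x u, dep u v, cle v y, ~ Q u & Q v].
Proof.
move=> H0; have H := clos_rt_rt1n _ _ _ _ H0; elim: H {H0} => {x y} [z //|u v w uv vw IH nQ Qw].
have {}vw := clos_rt1n_rt _ _ _ _ vw.
have [Qv|nQv] := pselect (Q v); first by exists u, v; split=> //; apply: cle_refl.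
have [u' [v' [h1 h2 h3 h4 h5]]] := IH nQv Qw.
by exists u', v'; split=> //; apply: cle_trans h1; apply: cle_dep.
Qed.

Lemma dep_some x y : dep x y -> isSome (E x) /\ isSome (E y).
Proof.
case=> j [p i]; have [_] := inn_lt p i; move: p; rewrite /part.
by case: (E x) => // ?; case: (E y).
Qed.

Lemma part_some x j : part x j -> isSome (E x).
Proof. by rewrite /part; case: (E x). Qed.

Lemma grow_gtrans k e : E k = Some e -> gtrans (ev_act e) (ev_tr e).
Proof. by move=> Ek; have [P [_ _ _ []]] := gE Ek. Qed.

Lemma part_ex k : isSome (E k) -> exists j, part k j.
Proof.
rewrite /part; case Ek: (E k) => [e|//] _.
have [H [_ [j aj]]] := grow_gtrans Ek; exists j; by rewrite H.
Qed.

(** If [x < y], then [y] consumes an output produced at or after [x], whereas [x] consumes one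
    produced strictly before [x]. *)
Lemma cfg_cf C j x y : cfg C -> C x -> C y -> part x j -> part y j ->
  inn x j = inn y j -> x = y.
Proof.
move=> cC; wlog xy : x y / x < y.
  move=> W Cx Cy px py H; case: (ltngtP x y) => // h; first exact: W.
  exact/esym/W.
move=> Cx Cy px py; have [_ /(_ _ py) ->] := cC _ Cy.
have [z -> xz] := top_max xy Cx px.
by move=> /(inn_lt px)[]; lia.
Qed.

Lemma cfg0 : cfg pred0. Proof. by []. Qed.

Lemma add_new N C k : cfg C -> (forall y, C y -> y < N) -> isSome (E k) ->
  (forall j, part k j -> inn k j = top N C j) -> ~~ C k.
Proof.
move=> cC bC Ek H; apply/negP => Ck; have [j pj] := part_ex Ek.
have [x tx kx] := top_max (bC _ Ck) Ck pj.
by have := H _ pj; rewrite tx => /(inn_lt pj)[]; lia.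
Qed.

(** The producer of the [j]-input of [k] is the last [j]-event of [C] and has index below [k]. So,
    although indices need not follow the firing order, they do so along each component of [k]. *)
Lemma add_lt N C k j y : cfg C -> (forall y, C y -> y < N) ->
  (forall j, part k j -> inn k j = top N C j) ->
  part k j -> C y -> part y j -> y < k.
Proof.
move=> cC bC H pk Cy py; have [x tx yx] := top_max (bC _ Cy) Cy py.
by have := H _ pk; rewrite tx => /(inn_lt pk)[]; lia.
Qed.

Lemma cfg_add N C k : cfg C -> (forall y, C y -> y < N) -> isSome (E k) ->
  (forall j, part k j -> inn k j = top N C j) -> cfg (addc C k).
Proof.
move=> cC bC Ek H x; rewrite /addc => /orP[/eqP->|Cx].
  split=> // j pk; rewrite H //.
  have -> : top N C j = top k C j.
    by apply: top_bound => y Cy py; [apply: bC|apply: add_lt cC bC H pk Cy py].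
  by apply: top_ext => y yk py; rewrite (ltn_eqF yk).
have [Ex Hx] := cC _ Cx; split=> // j px; rewrite Hx //.
apply: top_ext => y yx py; case: eqP => // ?; subst y.
by have := add_lt cC bC H py Cx px; lia.
Qed.

Lemma top_add N N' C k j : cfg C -> (forall y, C y -> y < N) ->
  (forall j, part k j -> inn k j = top N C j) -> N <= N' -> k < N' ->
  top N' (addc C k) j = if part k j then Some k else top N C j.
Proof.
move=> cC bC H NN' kN'; case: ifP => pk.
  apply: istop_uniq; split=> //; first by rewrite /addc eqxx.
  by move=> y _ /orP[/eqP->//|Cy] py; apply/ltnW/(add_lt cC bC H pk Cy py).
have -> : top N C j = top N' C j by apply: top_bound => y /bC; lia.
apply: top_ext => y _ py; rewrite /addc; case: eqP => // ?; subst y.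
by rewrite py in pk.
Qed.

Lemma agree_part P k j : agree P -> k < size P -> participates P k j = part k j.
Proof. by move=> aP kP; rewrite /participates /part aP. Qed.

Lemma agree_lt P k (e : Event A) : agree P -> onth P k = Some e ->
  k < size P /\ E k = Some e.
Proof.
move=> aP; have [lk|ge] := ltnP k (size P); first by rewrite aP.
by rewrite onth_default.
Qed.

Lemma agree_lab P o j : agree P -> (forall k, o = Some k -> k < size P) ->
  condlab P (o, j) = lab o j.
Proof.
move=> aP; rewrite /condlab /lab /=; case: o => [k|//] /(_ _ erefl) kP.
by rewrite aP.
Qed.

Lemma part_E k j (e : Event A) : E k = Some e -> part k j = isSome (ev_tr e j).
Proof. by rewrite /part => ->. Qed.

Lemma inn_E k j (e : Event A) : E k = Some e -> inn k j = ev_in e j.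
Proof. by rewrite /inn => ->. Qed.

(** Firing sequences are replaced by sets of fired events: enabledness of [k] says that its inputs
    are the current tops, so [cfg_add] and [top_add] follow each firing. *)
Lemma reach_cfg P M : agree P -> Reach P M ->
  exists C, [/\ cfg C, forall y, C y -> y < size P &
             forall c, M c <-> c.1 = top (size P) C c.2].
Proof.
move=> aP; elim=> {M} [|M k e _ [C [cC bC HM]] Pk pre].
  exists pred0; split=> // c.
  by rewrite (_ : top _ _ _ = None) //; apply: istop_uniq.
have [kP Ek] := agree_lt aP Pk.
have H j : part k j -> inn k j = top (size P) C j.
  rewrite (part_E _ Ek) (inn_E _ Ek) => pj; apply: (HM (ev_in e j, j)).1.
  by apply: pre; rewrite /preb /= pj eqxx.
have Ek' : isSome (E k) by rewrite Ek.
exists (addc C k); split.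
- exact: cfg_add H.
- by move=> y /orP[/eqP->//|/bC].
case=> o j /=; rewrite (top_add _ cC bC H (leqnn _) kP) (part_E _ Ek).
rewrite /preb /postb /=.
have /= HMj := HM (_, j).
split.
  move=> [[/HMj oe]|/andP[/eqP-> ->//]].
  case: ifP => //= pj; rewrite oe -H ?(part_E _ Ek) //.
  by rewrite (inn_E _ Ek) eqxx.
case: ifP => pj /= ->; first by right; rewrite eqxx.
by left; split=> //; apply/HMj.
Qed.

Definition past k : pred nat := fun x => `[<cle x k>].

Lemma pastP x k : past k x <-> cle x k.
Proof. by split=> [/asboolP|/asboolP]. Qed.

Lemma past_dc k x y : past k y -> dep x y -> past k x.
Proof. by move=> /pastP yk xy; apply/pastP; apply: cle_trans yk; apply: cle_dep. Qed.

Lemma past_le k x y : past k y -> cle x y -> past k x.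
Proof. by move=> /pastP yk xy; apply/pastP; apply: cle_trans yk. Qed.

Lemma past_refl k : past k k.
Proof. by apply/pastP; apply: cle_refl. Qed.

Lemma past_leq k x : past k x -> x <= k.
Proof. by move/pastP/cle_leq. Qed.

Lemma grow_cfg k : isSome (E k) -> exists C, [/\ cfg C, forall y, C y -> y < k &
  forall j, part k j -> inn k j = top k C j].
Proof.
case Ek: (E k) => [e|//] _; have [P [_ sP aP [_ [_ [[M [RM HM]] _]]]]] := gE Ek.
have [C [cC bC HC]] := reach_cfg aP RM; rewrite sP in bC HC; exists C; split=> // j.
rewrite (part_E _ Ek) (inn_E _ Ek) => pj.
exact: (HC (_, j)).1 (HM _ pj).
Qed.

(** A marking enabling [k] yields a configuration [C], and [[k]] is a causally closed subset of [C]
    extended by [k]. *)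
Lemma cfg_past k : isSome (E k) -> cfg (past k).
Proof.
move=> Ek; have [C [cC bC H]] := grow_cfg Ek.
have cCk := cfg_add cC bC Ek H.
apply: (cfg_sub cCk) => [x /pastP xk|]; last exact: past_dc.
by apply: cfg_le cCk _ xk; rewrite /addc eqxx.
Qed.

Lemma inn_past k j : part k j -> inn k j = top k (past k) j.
Proof.
move=> pk; have [_] := cfg_past (part_some pk) (past_refl k); exact.
Qed.

(* M(k)_j is the condition (tp k j, j). *)
Definition tp k j := top k.+1 (past k) j.

Lemma tp_part k j : part k j -> tp k j = Some k.
Proof. by move=> pk; rewrite /tp /= past_refl pk. Qed.

Lemma tpS k j x : tp k j = Some x -> cle x k /\ part x j.
Proof. by move/topS=> [_ /pastP]. Qed.

Lemma tp_top N k j : k < N -> top N (past k) j = tp k j.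
Proof.
by move=> kN; apply: top_bound => y /past_leq yk _; lia.
Qed.

Lemma lab_in k j (e : Event A) p : E k = Some e -> ev_tr e j = Some p -> lab (ev_in e j) j = p.1.
Proof.
move=> Ek Hp; have [P [_ sP aP [_ [H _]]]] := gE Ek.
have [_ <-] := H _ _ Hp; apply/esym/agree_lab => // x ix.
have pj : part k j by rewrite (part_E _ Ek) Hp.
by rewrite sP; have [] := @inn_lt k j x pj; rewrite ?(inn_E _ Ek).
Qed.

End Growth.

(** * The notions of the algorithm in terms of the causal order on events *)

Section Decoding.
Variables (Act : finType) (n : nat) (A : 'I_n -> LTS Act).
Variable E : nat -> option (Event A).
Hypothesis gE : grow E.
Implicit Types (C D : pred nat) (P : seq (Event A)) (j : 'I_n) (k x y z : nat).
Implicit Types (c d : cond n).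

Local Notation part := (part E).
Local Notation inn := (inn E).
Local Notation cle := (cle E).
Local Notation dep := (dep E).
Local Notation top := (top E).
Local Notation past := (past E).
Local Notation tp := (tp E).
Local Notation lab := (lab E).
Local Notation cfg := (cfg E).

(* The notions of the algorithm are decoded over any E extending P, hence agree
   for all later stages of a run. *)
Definition inE x c := part x c.2 /\ inn x c.2 = c.1.
Definition outE y d := d.1 = Some y /\ part y d.2.
Definition clt c d := exists x y, [/\ inE x c, cle x y & outE y d].

(** A closed form of the causal order on nodes, independent of [P]; a single proof of transitivity
    replaces inductions on paths of the net. *)
Definition nltE (u v : node n) : Prop :=
  match u, v with
  | NE x, NE y => x <> y /\ cle x y
  | NE x, NC d => exists2 y, cle x y & outE y d
  | NC c, NE y => exists2 x, inE x c & cle x y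
  | NC c, NC d => clt c d
  end.

Lemma out_in_dep y w d : outE y d -> inE w d -> dep y w.
Proof. by move=> [dy py] [pw iw]; exists d.2; rewrite iw. Qed.

Lemma cle_dep_cle x y z w : cle x y -> dep y z -> cle z w -> x <> w /\ cle x w.
Proof.
move=> xy yz zw; split; last first.
  by apply: cle_trans xy _; apply: cle_trans zw; apply: cle_dep.
by move=> xw; have := cle_leq gE xy; have := dep_lt gE yz; have := cle_leq gE zw; lia.
Qed.

Lemma nltE_trans u v w : nltE u v -> nltE v w -> nltE u w.
Proof.
case: u v w => [x|c] [y|d] [z|f] /=.
- move=> [nxy xy] [nyz yz]; split; last exact: cle_trans xy yz.
  move=> xz; rewrite -xz in yz. exact: nxy (cle_anti gE xy yz).
- by move=> [_ xy] [t yt tf]; exists t => //; apply: cle_trans xy yt.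
- move=> [t xt td] [s sd sz].
  exact: cle_dep_cle xt (out_in_dep td sd) sz.
- move=> [t xt td] [s [r [sd sr rf]]]; exists r => //.
  exact: (cle_dep_cle xt (out_in_dep td sd) sr).2.
- by move=> [x xc xy] [_ yz]; exists x => //; apply: cle_trans xy yz.
- by move=> [x xc xy] [t yt tf]; exists x, t; split=> //; apply: cle_trans xy yt.
- move=> [x [t [xc xt td]]] [s sd sz]; exists x => //.
  exact: (cle_dep_cle xt (out_in_dep td sd) sz).2.
- move=> [x [t [xc xt td]]] [s [r [sd sr rf]]]; exists x, r; split=> //.
  exact: (cle_dep_cle xt (out_in_dep td sd) sr).2.
Qed.

(** The consumer is the [j]-event of [C] outside [D] of least index: by minimality the producer of
    its input lies in [D], and [cfg_next] applies. *)
Lemma cfg_consume C D N j z : cfg C -> (forall y, D y -> C y) ->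
  (forall x y, D y -> dep x y -> D x) -> (forall y, D y -> y < N) ->
  C z -> ~~ D z -> part z j -> exists w, [/\ C w, part w j & inn w j = top N D j].
Proof.
move=> cC DC dcD bD Cz nDz pz.
have ex : exists z, [&& C z, ~~ D z & part z j] by exists z; rewrite Cz nDz.
case: (ex_minnP ex) => w /and3P[Cw nDw pw] wm.
exists w; split=> //; apply: (cfg_next cC DC dcD Cw nDw pw _ bD) => y iy.
have [yw py] := inn_lt gE pw iy.
apply/negPn/negP => nDy; have Cy : C y by apply: cfg_dc cC Cw _; exists j.
by have := wm y; rewrite Cy nDy py => /(_ isT); lia.
Qed.

Variable P : seq (Event A).
Hypothesis aP : agree E P.

Lemma agree_some k : k < size P -> isSome (E k).
Proof. by move=> kP; rewrite -(aP kP) onthTE. Qed.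

Lemma inpreE k c : inpre P k c -> inE k c.
Proof.
move=> [e [/(agree_lt aP)[kP Ek] /andP[h1 /eqP h2]]].
by rewrite /inE (part_E _ Ek) (inn_E _ Ek).
Qed.

Lemma inE_inpre k c : k < size P -> inE k c -> inpre P k c.
Proof.
move=> kP [pk ik]; have := agree_some kP; case Ek: (E k) => [e|//] _.
exists e; rewrite aP //; split=> //; rewrite /preb.
by rewrite (part_E _ Ek) in pk; rewrite (inn_E _ Ek) in ik; rewrite pk ik eqxx.
Qed.

Lemma part_lt k j : participates P k j -> k < size P.
Proof. by rewrite /participates; case: ltnP => // ge; rewrite onth_default. Qed.

Lemma outpostE k c : outpost P k c -> outE k c.
Proof. by move=> [ck pk]; split=> //; rewrite -(agree_part _ aP) // (part_lt pk). Qed.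

Lemma outE_outpost k c : k < size P -> outE k c -> outpost P k c.
Proof. by move=> kP [ck pk]; split=> //; rewrite (agree_part _ aP). Qed.

Lemma lt_n_nltE u v : lt_n P u v -> nltE u v.
Proof.
elim=> {u v} [[x|c] [y|d] //= |u v w _ uv _ vw]; last exact: nltE_trans uv vw.
  by move=> /outpostE xd; exists x => //; apply: cle_refl.
by move=> /inpreE yc; exists y => //; apply: cle_refl.
Qed.

Lemma cle_le_n x y : y < size P -> cle x y -> le_n P (NE n x) (NE n y).
Proof.
move=> yP H; elim: (clos_rt_rt1n _ _ _ _ H) yP => {x y H} [z|x z w [j [pz iz]] zw IH] wP.
  by left.
have zP : z < size P.
  by apply: leq_ltn_trans wP; apply: (cle_leq gE); apply: (clos_rt1n_rt _ _ _ _ zw).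
have [xz px] := inn_lt gE pz iz.
have xz_n : lt_n P (NE n x) (NE n z).
  apply: (t_trans _ _ _ (NC (Some x, j))); apply: t_step => /=.
    by apply: outE_outpost; [lia|].
  exact: inE_inpre.
right; case: (IH wP) => [<-//|]; exact: t_trans.
Qed.

Lemma le_nP x y : y < size P -> le_n P (NE n x) (NE n y) <-> cle x y.
Proof.
move=> yP; split; last exact: cle_le_n.
case=> [[->]|/lt_n_nltE[]//]; exact: cle_refl.
Qed.

Lemma lt_nP x y : y < size P -> lt_n P (NE n x) (NE n y) <-> (x <> y /\ cle x y).
Proof.
move=> yP; split; first exact: lt_n_nltE.
by move=> [nxy /(cle_le_n yP)[[]|]].
Qed.

Lemma lt_cltP c d : (forall y, d.1 = Some y -> y < size P) ->
  lt_n P (NC c) (NC d) <-> clt c d.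
Proof.
move=> bd; split; first exact: lt_n_nltE.
move=> [x [y [xc xy yd]]]; have yP : y < size P by apply: bd; case: yd.
have xP : x < size P by apply: leq_ltn_trans yP; exact: (cle_leq gE xy).
have h1 : lt_n P (NC c) (NE n x) by apply: t_step; apply: inE_inpre.
have h2 : lt_n P (NE n y) (NC d) by apply: t_step; apply: outE_outpost.
apply: t_trans h1 _; case: (cle_le_n yP xy) => [[->]//|h3].
exact: t_trans h3 h2.
Qed.

(** A condition available in [[k]] that is not the last of its component is consumed in [[k]], by
    [cfg_consume]; the last one is not, since its consumer would be a later event of that
    component. *)
Lemma MarkP k o j : k < size P -> Mark P k (o, j) <-> o = tp k j.
Proof.
move=> kP; have Ek := agree_some kP; have cK := cfg_past gE Ek.
split.
  move=> [/= src nc]; apply: contrapT => otp.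
  suff [w [/pastP wk pw iw]] : exists w, [/\ past k w, part w j & inn w j = o].
    apply: nc; exists w; split; first exact: cle_le_n.
    apply: inE_inpre => //; apply: leq_ltn_trans kP; exact: (cle_leq gE wk).
  have src' : o = None \/ exists2 x, o = Some x & cle x k /\ part x j.
    case: src => [|[x [-> [/outpostE[_ px]] /(le_nP _ kP)]]]; first by left.
    by right; exists x.
  case: src' otp => [->|[x -> [xk px]]] otp.
    case Et: (tp k j) otp => [t|//] _; have [tk pt] := tpS Et.
    have := @cfg_consume (past k) pred0 k.+1 j t cK.
    rewrite (_ : top _ pred0 _ = None); last exact: istop_uniq.
    by apply=> //; apply/pastP.
  have kx := cle_leq gE xk.
  have xk' : x < k.+1 by [].
  have [t Et xt] := top_max xk' ((pastP E x k).2 xk) px.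
  have [_ tk pt] := topS Et.
  have tx : ~~ past x t.
    apply/negP => /past_leq -/(_ gE) tx; apply: otp; rewrite /tp Et.
    by congr Some; lia.
  have Ex := part_some px.
  (* The smaller configuration is [[x]], whose last [j]-event is [x] itself, so the consumer found
     takes the output of [x]. *)
  have [w [h1 h2 h3]] := @cfg_consume (past k) (past x) x.+1 j t cK
    (fun y yx => past_le ((pastP E x k).2 xk) ((pastP E y x).1 yx))
    (@past_dc _ _ _ _ x) (fun y yx => past_leq gE yx) tk tx pt.
  by exists w; split=> //; rewrite h3 -/(tp x j) tp_part.
move=> ->; split=> /=.
  case Et: (tp k j) => [t|]; [right; exists t|by left].
  have [tk pt] := tpS Et; split=> //.
  have tP : t < size P by apply: leq_ltn_trans kP; exact: (cle_leq gE tk).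
  by split; [apply: outE_outpost|apply: cle_le_n].
move=> [x [/(le_nP _ kP) xk /inpreE[/= px ix]]].
have xk' : x < k.+1 by have := cle_leq gE xk; lia.
have [t Et xt] := top_max xk' ((pastP E x k).2 xk) px.
by rewrite /tp Et in ix; have [] := inn_lt gE px ix; lia.
Qed.

Definition sst k k' := forall j, lab (tp k j) j = lab (tp k' j) j.

Lemma tp_lt k j x : k < size P -> tp k j = Some x -> x < size P.
Proof. by move=> kP /tpS[/(cle_leq gE) xk _]; lia. Qed.

Lemma sameStP k k' : k < size P -> k' < size P -> sameSt P k k' <-> sst k k'.
Proof.
move=> kP kP'; split=> H j.
  have := H j _ _ ((MarkP _ _ kP).2 erefl) ((MarkP _ _ kP').2 erefl).
  by rewrite !(agree_lab _ aP) // => x; apply: tp_lt.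
move=> o o' /(MarkP _ _ kP)-> /(MarkP _ _ kP')->.
by rewrite !(agree_lab _ aP) ?H // => x; apply: tp_lt.
Qed.

Definition strongE k' k := [/\ k' <> k, cle k' k &
  forall j j', tp k j <> tp k' j -> tp k' j' <> tp k j' ->
    clt (tp k' j', j') (tp k j, j)].

Lemma strongP k' k : k < size P -> k' < size P -> strong P k' k <-> strongE k' k.
Proof.
move=> kP kP'; split.
  move=> [/(lt_nP _ kP)[ne le] H]; split=> // j j' h1 h2.
  apply/lt_cltP; first by move=> y /=; apply: tp_lt.
  by apply: H; rewrite !MarkP // => /esym.
move=> [ne le H]; split; first by apply/lt_nP.
move=> [o j] [o' j']; rewrite !MarkP // => -> h1 -> h2.
apply/lt_cltP; first by move=> y /=; apply: tp_lt.
exact: H.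
Qed.

Definition confE x y := exists c k1 k2,
  [/\ k1 <> k2, inE k1 c, inE k2 c, cle k1 x & cle k2 y].
Definition concE x y := [/\ ~ cle x y, ~ cle y x & ~ confE x y].

Lemma concurrentP x y : x < size P -> y < size P ->
  concurrent P (NE n x) (NE n y) <-> concE x y.
Proof.
move=> xP yP; rewrite /concurrent /concE !le_nP //.
suff -> : conflict P (NE n x) (NE n y) = confE x y by split=> [[?[? ?]]|[]].
apply/propext; split.
  move=> [c [k1 [k2 [ne [/inpreE h1 [/inpreE h2]]]]]]; rewrite !le_nP // => -[h3 h4].
  by exists c, k1, k2.
move=> [c [k1 [k2 [ne h1 h2 h3 h4]]]]; exists c, k1, k2.
rewrite !le_nP //; do !split=> //; apply: inE_inpre => //.
  by have := cle_leq gE h3; lia.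
by have := cle_leq gE h4; lia.
Qed.

Variable i : 'I_n.

Lemma sameIpP k k' : k < size P -> k' < size P -> sameIp i P k k' <-> tp k i = tp k' i.
Proof.
move=> kP kP'; split=> [H|H o]; last by rewrite !MarkP ?H.
by have := (H (tp k i)).1; rewrite !MarkP //; apply.
Qed.

Lemma companionP k k' : k < size P ->
  companion i P k k' <-> [/\ k' < k, part k' i & sst k k'].
Proof.
move=> kP; rewrite /companion; split.
  move=> [kk []]; have kP' : k' < size P by lia.
  by rewrite sameStP // (agree_part _ aP).
move=> [kk]; have kP' : k' < size P by lia.
by rewrite sameStP // (agree_part _ aP).
Qed.

Definition cutE k := part k i /\ exists k', [/\ k' < k, part k' i & sst k k'].

Lemma cutoffP k : k < size P -> cutoff i P k <-> cutE k.
Proof.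
move=> kP; rewrite /cutoff /cutE (agree_part _ aP) //.
by split=> -[h [k' hk]]; split=> //; exists k'; apply/companionP.
Qed.

(** [N] is the size of the current process: [E] may extend further, but only events of index below
    [N] are compared. *)
Definition candE N (co : nat -> Prop) k := ~~ part k i /\
  exists k', [/\ k' < N, strongE k' k, sst k k', tp k i = tp k' i &
    forall x, x < N -> part x i -> ~ co x -> concE x k -> concE x k'].

Lemma candidateP co k : k < size P -> candidate i co P k <-> candE (size P) co k.
Proof.
move=> kP; rewrite /candidate /candE (agree_part _ aP) //.
split=> -[h [k']].
  move=> [kP' [/(strongP kP kP') h1 [/(sameStP kP kP') h2 [/(sameIpP kP kP') h3 h4]]]].
  split=> //; exists k'; split=> // x xP px cox xk.
  have : Con i co P k x by rewrite /Con (agree_part _ aP) // concurrentP.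
  by move=> /h4; rewrite /Con concurrentP // => -[_ [_ []]].
move=> [kP' h1 h2 h3 h4]; split=> //; exists k'; split=> //.
rewrite strongP // sameStP // sameIpP //.
do 3!split=> //; move=> x [xP []]. 
rewrite (agree_part _ aP) // concurrentP // => px [cox xk].
by rewrite /Con (agree_part _ aP) // concurrentP //; do 3!split=> //; apply: h4.
Qed.

End Decoding.

(** * Invariant of the algorithm *)

Lemma onth_rcons (T : Type) (s : seq T) x k :
  onth (rcons s x) k = if k == size s then Some x else onth s k.
Proof.
rewrite -cats1 onth_cat; case: ltngtP => [//|ks|->]; last by rewrite subnn.
by rewrite !onth_default //=; lia.
Qed.

Section Invariant.
Variables (Act : finType) (n : nat) (A : 'I_n -> LTS Act) (i : 'I_n).
Implicit Types (P N : seq (Event A)).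

Lemma dep_ext (E E' : nat -> option (Event A)) x y :
  E y = E' y -> dep E x y -> dep E' x y.
Proof. by rewrite /dep /part /inn => ->. Qed.

Lemma agree_rcons P e : agree (onth (rcons P e)) P.
Proof. by move=> x xP; rewrite onth_rcons ltn_eqF. Qed.

Lemma onth_rcons_last P e : onth (rcons P e) (size P) = Some e.
Proof. by rewrite onth_rcons eqxx. Qed.

Lemma bp_grow P : bp P -> grow (onth P).
Proof.
elim=> [k e|{}P e bpP IH pe k e']; first by rewrite onth_default.
rewrite onth_rcons; case: eqP => [-> [<-]|_].
  by exists P; split=> //; apply: agree_rcons.
move=> Pk; have [Q [bQ sQ aQ peQ]] := IH _ _ Pk; exists Q; split=> // x xQ.
rewrite aQ // onth_rcons; case: eqP => // xP.
by have [] := agree_lt (fun x _ => erefl) Pk; lia.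
Qed.

(** Eligibility keeps the events of [co] and [coc] free of successors; the removal of freed events
    keeps every member of [coc] a candidate of the current process. *)
Definition alg_inv (s : astate A) := let: (P, co, coc) := s in
  [/\ bp P,
      forall k, co k \/ coc k -> k < size P /\ forall y, ~ dep (onth P) k y,
      forall k, co k -> cutoff i P k &
      forall k, coc k -> candidate i co P k].

Lemma cutoff_rcons P e k : bp P -> poss_ext P e -> k < size P ->
  cutoff i P k <-> cutoff i (rcons P e) k.
Proof.
move=> bP pe kP; have g' := bp_grow (bpS bP pe).
rewrite (cutoffP g' (@agree_rcons P e)) //.
by rewrite (cutoffP g' (fun x _ => erefl)) // size_rcons; lia.
Qed.

(* Con_i only changes when a non-cut-off i-event is added. *)
Lemma candidate_rcons P e k (co co' : nat -> Prop) : bp P -> poss_ext P e -> k < size P ->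
  (forall x, x < size P -> co x -> co' x) ->
  (participates (rcons P e) (size P) i -> co' (size P)) ->
  candidate i co P k -> candidate i co' (rcons P e) k.
Proof.
move=> bP pe kP coco' new; have g' := bp_grow (bpS bP pe).
have kP' : k < size (rcons P e) by rewrite size_rcons; lia.
rewrite (candidateP g' (@agree_rcons P e)) // (candidateP g' (fun x _ => erefl)) //.
move=> [h [k' [h1 h2 h3 h4 h5]]]; split=> //; exists k'; split=> //.
  by rewrite size_rcons; lia.
move=> x; rewrite size_rcons ltnS leq_eqVlt => /orP[/eqP->|xP] px cox; last first.
  by apply: h5 => // /coco'; auto.
by case: cox; apply: new; rewrite (agree_part _ (fun x _ => erefl)) // size_rcons.
Qed.

Lemma alg_inv_step s s' : alg_inv s -> astep i s s' -> alg_inv s'.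
Proof.
case: s => [[P co] coc] [bP succ cof cand] [e [[pe el] H]].
have bP' := bpS bP pe; have g' := bp_grow bP'.
have succ' k : co k \/ coc k \/ k = size P ->
    k < size (rcons P e) /\ forall y, ~ dep (onth (rcons P e)) k y.
  move=> H'.
  have {H'} [->|hk] : k = size P \/ (co k \/ coc k) by tauto.
    split=> [|y dy]; first by rewrite size_rcons.
    by have := dep_lt g' dy; have [_] := dep_some g' dy; rewrite onthTE size_rcons; lia.
  have [kP nd] := succ k hk; split=> [|y dy]; first by rewrite size_rcons; lia.
  have [_] := dep_some g' dy; rewrite onthTE size_rcons ltnS leq_eqVlt.
  case/orP=> [/eqP yE|yP]; last first.
    by apply: (nd y); apply: dep_ext dy; rewrite (@agree_rcons P e).
  apply: el; exists k; split=> //; apply/(le_nP g' (fun x _ => erefl)).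
    by rewrite size_rcons.
  by rewrite -yE; apply: cle_dep.
have cof' k : co k -> cutoff i (rcons P e) k.
  move=> ck; have [kP _] := succ k (or_introl ck).
  by apply/(cutoff_rcons bP pe kP)/cof.
case: H => [[cx ->]|[ncx [candx ->]]|[ncx [ncand ->]]]; split=> //.
- by move=> k [[|->]|]; auto.
- by move=> k [|->]; auto.
- move=> k ck; have [kP _] := succ k (or_intror ck).
  by apply: candidate_rcons (cand _ ck) => // *; auto.
- move=> k [ck|->//]; have [kP _] := succ k (or_intror ck).
  by apply: candidate_rcons (cand _ ck) => // px; case: candx; rewrite px.
- by move=> k [|[]]; auto.
(* An event kept in [coc] was a candidate before, by the invariant, and is not freed, so it still is
   one. *)
- by move=> k [ck nf]; apply: contrapT => nc; apply: nf; auto.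
Qed.

Lemma alg_inv_reach s : clos_refl_trans (astate A) (@astep _ _ A i) (ainit A) s -> alg_inv s.
Proof.
move=> H; elim: (clos_rt_rtn1 _ _ _ _ H) => [|s1 s2 st _]; last by move/alg_inv_step; apply.
by split=> //; [apply: bp0|move=> k []].
Qed.

End Invariant.

(** * Finite runs of a transition system *)

Section Runs.
Variables (State Act : Type) (step : State -> Act -> State -> Prop).

Fixpoint run (g : State) (w : seq Act) (g' : State) : Prop :=
  if w is a :: w' then exists2 g1, step g a g1 & run g1 w' g' else g = g'.

Lemma run_cat g1 w1 g2 w2 g3 : run g1 w1 g2 -> run g2 w2 g3 -> run g1 (w1 ++ w2) g3.
Proof.
by elim: w1 g1 => /= [g1 ->//|a w1 IH g1 [g st r] r2]; exists g => //; apply: IH r r2.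
Qed.

Lemma run_rcons g1 w g2 a g3 : run g1 w g2 -> step g2 a g3 -> run g1 (rcons w a) g3.
Proof. by move=> r st; rewrite -cats1; apply: run_cat r _; exists g3. Qed.

Lemma fin_run_cat g w g' u : run g w g' -> fin_run step g' u -> fin_run step g (w ++ u).
Proof.
by elim: w g => /= [g ->//|a w IH g [g1 st r] r2]; exists g1; split=> //; apply: IH r r2.
Qed.

Lemma fin_run_prefix g w u : fin_run step g (w ++ u) -> fin_run step g w.
Proof. by elim: w g => //= a w IH g [g' [st r]]; exists g'; split=> //; apply: IH. Qed.

Lemma fin_run_inf (rho : nat -> State) f N k :
  (forall k, step (rho k) (f k) (rho k.+1)) ->
  fin_run step (rho k) (map f (iota k N)).
Proof. by move=> H; elim: N k => //= N IH k; exists (rho k.+1); split. Qed.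

End Runs.

(** * Executions read off a finite branching process *)

Section FiniteProcess.
Variables (Act : finType) (n : nat) (A : 'I_n -> LTS Act) (i : 'I_n).
Variable P : seq (Event A).
Hypothesis bP : bp P.
Implicit Types (C D : pred nat) (j : 'I_n) (k x y z : nat).

Local Notation E := (onth P).
Local Notation N := (size P).
Local Notation part := (part E).
Local Notation inn := (inn E).
Local Notation dep := (dep E).
Local Notation top := (top E).
Local Notation past := (past E).
Local Notation tp := (tp E).
Local Notation lab := (lab E).
Local Notation cfg := (cfg E).
Local Notation run := (run (@gstep _ _ A)).

Let gE : grow E := bp_grow bP.
Let aP : agree E P := fun x _ => erefl.

Definition St C : gstate A := fun j => lab (top N C j) j.

Lemma cfg_lt C x : cfg C -> C x -> x < N.
Proof. by move=> cC /cC[]; rewrite onthTE. Qed.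

Lemma St_ext C D : (forall x, x < N -> C x = D x) -> St C = St D.
Proof.
move=> H; apply: functional_extensionality_dep => j; rewrite /St.
by rewrite (@top_ext _ _ _ _ _ _ D) // => y yN _; apply: H.
Qed.

Lemma St_past k j : k < N -> St (past k) j = lab (tp k j) j.
Proof. by move=> kN; rewrite /St (tp_top gE). Qed.

Lemma fire C x e : cfg C -> E x = Some e ->
  (forall j, part x j -> inn x j = top N C j) ->
  gstep (St C) (ev_act e) (St (addc C x)).
Proof.
move=> cC Ex H; exists (ev_tr e); split; first exact: grow_gtrans gE _ _ Ex.
have [xN _] := agree_lt aP Ex.
move=> j; rewrite /St (top_add gE _ cC (fun y => @cfg_lt C y cC) H (leqnn _) xN).
rewrite (part_E _ Ex); case Et: (ev_tr e j) => [p|//] /=.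
rewrite -H ?(part_E _ Ex) ?Et // (inn_E _ Ex) (lab_in gE Ex Et); split=> //.
by rewrite Ex Et.
Qed.

Definition labs C0 C := pmap (fun x => omap (@ev_act _ _ A) (E x))
  [seq x <- iota 0 N | C x && ~~ C0 x].

Lemma cfg_mid C0 C m : cfg C0 -> cfg C -> (forall x, C0 x -> C x) ->
  cfg (fun x => C0 x || C x && (x < m)).
Proof.
move=> c0 cC sub; apply: (cfg_sub cC) => [x /orP[/sub|/andP[]]//|x y].
case/orP=> [Cy|/andP[Cy ym]] xy; first by rewrite (cfg_dc c0 Cy xy).
by rewrite (cfg_dc cC Cy xy) /= (ltn_trans (dep_lt gE xy) ym) orbT.
Qed.

(** Index order refines causality, so the events of [C] outside [C0] can be fired by increasing
    index, through the configurations of [cfg_mid]. *)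
Lemma run_cfg C0 C : cfg C0 -> cfg C -> (forall x, C0 x -> C x) ->
  run (St C0) (labs C0 C) (St C).
Proof.
move=> c0 cC sub; pose mid m : pred nat := fun x => C0 x || C x && (x < m).
suff H m : m <= N -> run (St C0) (pmap (fun x => omap (@ev_act _ _ A) (E x))
   [seq x <- iota 0 m | C x && ~~ C0 x]) (St (mid m)).
  have := H N (leqnn _); congr (run _ _ _); apply: St_ext => x xN.
  by rewrite /mid xN andbT; case C0x: (C0 x) => //=; rewrite sub.
elim: m => [|m IH] mN.
  by apply: St_ext => x _; rewrite /mid ltn0 andbF orbF.
have {}IH := IH (ltnW mN).
rewrite -addn1 iotaD add0n filter_cat pmap_cat addn1 /=.
have cm : cfg (mid m) := @cfg_mid _ _ m c0 cC sub.
case: ifP => [/andP[Cm nm]|nH]; last first.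
  rewrite cats0; move: IH; congr (run _ _ _); apply: St_ext => x _; rewrite /mid ltnS.
  case C0x: (C0 x) => //=; case Cx: (C x) => //=.
  rewrite [x <= m]leq_eqVlt; case: eqP => // xm; subst x; by rewrite Cx C0x in nH.
have [] := cC _ Cm; case Em: (E m) => [e|//] _ Hm /=.
rewrite Em /= cats1; apply: run_rcons IH _.
have -> : St (mid m.+1) = St (addc (mid m) m).
  apply: St_ext => x _; rewrite /mid /addc ltnS.
  case: eqP => [->|/eqP xm]; first by rewrite Cm leqnn orbT.
  by rewrite leq_eqVlt (negbTE xm).
apply: fire => // j pm.
apply: (cfg_next cC) => // [y|y z mz yz||y iy|y]; last exact: cfg_lt.
- by case/orP=> [/sub|/andP[]].
- exact: cfg_dc cm mz yz.
- by rewrite /mid ltnn andbF orbF.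
- have ym : dep y m by exists j.
  by rewrite /mid (cfg_dc cC Cm ym) (dep_lt gE ym) orbT.
Qed.

Lemma act_vis x e j : E x = Some e -> (ev_act e \in lsig (A j)) = part x j.
Proof. by move=> Ex; have [<- _] := grow_gtrans gE Ex; rewrite (part_E _ Ex). Qed.

Lemma labs_invis C0 C : (forall x, C x -> ~~ C0 x -> ~~ part x i) ->
  all (fun a => a \notin lsig (A i)) (labs C0 C).
Proof.
move=> H; rewrite /labs; elim: (iota 0 N) => //= x s IH; case: ifP => //= /andP[Cx C0x].
by case Ex: (E x) => [e|] //=; rewrite IH andbT (act_vis _ Ex) H.
Qed.

Lemma size_labs C0 C : size (labs C0 C) <= count (fun x => C x && ~~ C0 x) (iota 0 N).
Proof. by rewrite size_pmap -(size_filter (fun x => C x && ~~ C0 x)); apply: count_size. Qed.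

Definition pasto (o : option nat) : pred nat := if o is Some k then past k else pred0.

Lemma cfg_pasto o : (forall k, o = Some k -> k < N) -> cfg (pasto o).
Proof.
case: o => [k|] H; last exact: cfg0.
by apply: cfg_past => //; rewrite onthTE; apply: H.
Qed.

(** The invariant of the folding: equivalent conditions will have the same [Stc]. *)
Definition Stc (c : cond n) := St (pasto c.1).

Lemma St0 : St pred0 = ginit A.
Proof.
apply: functional_extensionality_dep => j; rewrite /St.
by rewrite (_ : top _ _ _ = None) //; apply: istop_uniq.
Qed.

(** Every [i]-event of [[k]] other than [k] is at or below the producer of the [i]-input of [k].
    Starting from the past of that producer, the remaining events of [[k]] are thus silent until
    [k], which is fired last. *)
Lemma istep_run c a c' : istep i P c a c' ->
  [/\ a \in lsig (A i) & exists2 w, run (Stc c) (rcons w a) (Stc c') &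
     all (fun a => a \notin lsig (A i)) w].
Proof.
move=> [k [e [Ek [<- [pe [-> ->]]]]]].
have pk : part k i by rewrite (part_E _ Ek).
split; first by rewrite (act_vis _ Ek).
rewrite /Stc /= -(inn_E _ Ek).
have Ek' : isSome (E k) by rewrite Ek.
have kN : k < N by rewrite -onthTE.
have cK := cfg_past gE Ek'.
pose D : pred nat := fun x => past k x && (x != k).
have dcD x y : D y -> dep x y -> D x.
  move=> /andP[yk _] xy; rewrite /D (past_dc yk xy) /=.
  by have := past_leq gE yk; have := dep_lt gE xy; lia.
have DK x : D x -> past k x by case/andP.
have cD := cfg_sub cK DK dcD.
have ilt x : inn k i = Some x -> x < N /\ D x.
  move=> ik; have [xk _] := inn_lt gE pk ik; split; first by lia.
  apply/andP; split; last by lia.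
  by apply/pastP/cle_dep; exists i.
have co : cfg (pasto (inn k i)) by apply: cfg_pasto => x /ilt[].
exists (labs (pasto (inn k i)) D); last first.
  apply: labs_invis => x /andP[xk /eqP nxk]; apply: contra => px.
  have xk' : x < k by have := past_leq gE xk; lia.
  have := inn_past gE pk; have [z Et xz] := top_max xk' xk px.
  rewrite Et => ->; have [zk zK pz] := topS Et.
  by apply/pastP; apply: cfg_line cK xk zK px pz xz.
apply: run_rcons.
  apply: run_cfg => // x.
  case Ei: (inn k i) => [y|//] /pastP xy.
  by apply: cfg_le cD _ xy; apply: (ilt _ Ei).2.
have -> : St (past k) = St (addc D k).
  apply: St_ext => x _; rewrite /addc /D; case: eqP => [->|_]; last by rewrite andbT.
  by rewrite past_refl.
apply: fire => // j pj; apply: (cfg_next cK) => //.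
- by rewrite past_refl.
- by rewrite /D eqxx andbF.
- move=> y iy; have ym : dep y k by exists j.
  by apply/andP; split; [apply/pastP/cle_dep|have := dep_lt gE ym; lia].
- by move=> y; apply: cfg_lt.
Qed.

End FiniteProcess.

Lemma filter_invis (T : Type) (p : pred T) w : all (fun a => ~~ p a) w -> filter p w = [::].
Proof. by elim: w => //= a w IH /andP[/negbTE-> /IH]. Qed.

Lemma count_disjoint (T : Type) (a b c : pred T) s :
  (forall x, a x -> c x) -> (forall x, b x -> c x) ->
  (forall x, a x -> b x -> false) -> count a s + count b s <= count c s.
Proof.
move=> ac bc ab; elim: s => //= x s IH.
have : a x + b x <= c x.
  by case ax: (a x) (ac x) (ab x); case: (b x) (bc x); case: (c x) => // ? ? ?; auto.
by lia.
Qed.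

(** * Concatenating infinitely many finite segments *)

Section Concatenation.
Variables (State Act : Type) (step : State -> Act -> State -> Prop) (vis : pred Act).
Variables (S : nat -> State) (g : nat -> Act).
Hypothesis vg : forall k, vis (g k).
Hypothesis seg : forall k, exists2 w,
  run step (S k) (rcons w (g k)) (S k.+1) & all (fun a => ~~ vis a) w.

(* A position (k, s, d) sits in the k-th segment at state s, d silent steps
   before its visible step. *)
Let pos := (nat * State * nat)%type.
Let ok (x : pos) := exists w, [/\ size w = x.2, all (fun a => ~~ vis a) w &
  run step x.1.2 (rcons w (g x.1.1)) (S x.1.1.+1)].
Let move (x y : pos) a := step x.1.2 a y.1.2 /\
  ((y.1.1 = x.1.1 /\ ~~ vis a /\ x.2 = y.2.+1) \/
   (y.1.1 = x.1.1.+1 /\ x.2 = 0 /\ a = g x.1.1)).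

Lemma ok_start k : exists d, ok (k, S k, d).
Proof. by have [w r v] := seg k; exists (size w), w. Qed.

Lemma ok_move x : exists ya : pos * Act, ok x -> ok ya.1 /\ move x ya.1 ya.2.
Proof.
(* A default value outside the valid positions lets [choice] produce a total successor function. *)
case: (pselect (ok x)) => [|nok]; last by exists (x, g 0).
case: x => [[k s] d] [[|a w] [/= sw vw r]].
  case: r => s' st /= se; have [d' okd] := ok_start k.+1.
  exists ((k.+1, S k.+1, d'), g k) => _; split=> //=.
  by split; [rewrite -se|right].
case: r => s' st r; exists ((k, s', size w), a) => _; case/andP: vw => va vw.
by split; [exists w|split=> //; left].
Qed.

(** The successor function is iterated. The count of remaining silent steps decreases, so every
    segment ends; the segment number [K] grows exactly at visible steps, and [phi k] is the time at
    which segment [k] ends. *)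
Lemma run_inf : exists rho f (phi : nat -> nat),
  [/\ rho 0 = S 0, forall m, step (rho m) (f m) (rho m.+1),
      forall k, phi k < phi k.+1,
      forall m, vis (f m) <-> exists k, phi k = m &
      forall k, g k = f (phi k)].
Proof.
have [F HF] := choice ok_move; have [d0 ok0] := ok_start 0.
pose X m := iter m (fun x => (F x).1) (0, S 0, d0); pose f m := (F (X m)).2.
have okX m : ok (X m) by elim: m => //= m IH; have [] := HF _ IH.
have mv m : move (X m) (X m.+1) (f m) by have [] := HF _ (okX m).
pose K m := (X m).1.1.
have vK m : if vis (f m) then K m.+1 = (K m).+1 /\ f m = g (K m) else K m.+1 = K m.
  have [_ [[h1 [h2 h3]]|[h1 [h2 h3]]]] := mv m; first by rewrite (negbTE h2).
  by rewrite h3 vg.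
have Kmono m m' : m <= m' -> K m <= K m'.
  move/subnKC <-; elim: (m' - m) => [|t IH]; first by rewrite addn0.
  by apply: leq_trans IH _; rewrite addnS; have := vK (m + t); case: ifP => _; lia.
have progress m : exists m', K m' = K m /\ vis (f m').
  have [d] := ubnP (X m).2; elim: d m => // d IH m md.
  have := vK m; case: ifP => [v _|nv Km]; first by exists m.
  have [_ [[_ [_ h3]]|[_ [_ h3]]]] := mv m; last by rewrite h3 vg in nv.
  by have [|m' [h v]] := IH m.+1; [lia|exists m'; rewrite h].
have exphi k : exists m, K m = k /\ vis (f m).
  elim: k => [|k [m [Km v]]]; first by have [m] := progress 0; exists m.
  have [m' [h1 h2]] := progress m.+1; exists m'; split=> //.
  by have := vK m; rewrite v h1 => -[-> _]; rewrite Km.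
have [phi Hphi] := choice exphi.
have Kuniq m m' : K m = K m' -> vis (f m) -> vis (f m') -> m = m'.
  wlog mm : m m' / m < m' => [W|].
    by move=> h v v'; case: (ltngtP m m') => // h'; [|symmetry]; apply: W.
  by move=> h v v'; have := vK m; rewrite v; have := Kmono _ _ mm; lia.
exists (fun m => (X m).1.2), f, phi; split=> //.
- by move=> m; have [] := mv m.
- move=> k; rewrite ltnNge; apply/negP => /Kmono.
  by have [-> _] := Hphi k; have [-> _] := Hphi k.+1; lia.
- move=> m; split=> [v|[k <-]]; last by have [] := Hphi k.
  by exists (K m); have [h1 h2] := Hphi (K m); apply: Kuniq.
- by move=> k; have [h1 h2] := Hphi k; have := vK (phi k); rewrite h2 h1 => -[].
Qed.

End Concatenation.

(** * Soundness of the folding; extending configurations in the final process *)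

Section Summary.
Variables (Act : finType) (n : nat) (A : 'I_n -> LTS Act) (i : 'I_n).
Variables (P : seq (Event A)) (co coc : nat -> Prop).
Hypothesis invP : alg_inv i (P, co, coc).
Implicit Types (C D : pred nat) (j : 'I_n) (k x y z : nat).

Local Notation E := (onth P).
Local Notation N := (size P).
Local Notation part := (part E).
Local Notation inn := (inn E).
Local Notation cle := (cle E).
Local Notation dep := (dep E).
Local Notation top := (top E).
Local Notation past := (past E).
Local Notation tp := (tp E).
Local Notation lab := (lab E).
Local Notation cfg := (cfg E).
Local Notation run := (run (@gstep _ _ A)).
Local Notation St := (St P).
Local Notation Stc := (Stc P).
Local Notation pasto := (pasto P).
Local Notation vis := (fun a => a \in lsig (A i)).

Let bP : bp P. Proof. by case: invP. Qed.
Let gE : grow E := bp_grow bP.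
Let aP : agree E P := fun x _ => erefl.

Lemma co_part k : co k -> k < N /\ part k i.
Proof.
case: invP => _ _ cof _ /cof[pk _]; have kN := part_lt pk.
by rewrite -(agree_part _ aP).
Qed.

Lemma companion_St k k' : k < N -> companion i P k k' -> St (past k) = St (past k').
Proof.
move=> kN /(companionP gE aP _ _ kN)[kk' pk' H].
apply: functional_extensionality_dep => j; rewrite !(St_past bP) //.
by lia.
Qed.

Lemma fold_gen_St b b' : fold_gen i P co b b' -> Stc b = Stc b'.
Proof.
case: b b' => [o j] [o' j'] [k [k' [/co_part[kN pk] [cmp [mk [/= ej [mk' /= ej']]]]]]].
subst j j'.
have kN' : k' < N by have [] := cmp; lia.
have /(companionP gE aP _ _ kN)[_ pk' _] := cmp.
move: mk mk'; rewrite !(MarkP gE aP) // !tp_part // => -> ->.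
exact: companion_St.
Qed.

Lemma fold_eq_St b b' : fold_eq i P co b b' -> Stc b = Stc b'.
Proof. by elim=> [? ? /fold_gen_St|//|? ? _ ->|? ? ? _ -> _ ->]. Qed.

Lemma fstep_run b a b' : fstep i P co b a b' ->
  vis a /\ exists2 w, run (Stc b) (rcons w a) (Stc b') & all (fun a => ~~ vis a) w.
Proof.
move=> [c [c' [/(istep_run bP)[va [w r vw]] [/fold_eq_St-> /fold_eq_St->]]]].
by split=> //; exists w.
Qed.

Lemma fold_sound_fin b w : fin_run (fstep i P co) b w ->
  exists2 u, fin_run (@gstep _ _ A) (Stc b) u & filter vis u = w.
Proof.
elim: w b => [|a w IH] b /=; first by exists [::].
move=> [b' [/fstep_run[va [v r vv]] /IH[u ru <-]]].
exists (rcons v a ++ u); first exact: fin_run_cat r ru.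
by rewrite filter_cat filter_rcons va filter_invis.
Qed.

Lemma fold_sound w : is_trace (fstep i P co) (fold_init i) w ->
  exists u, is_trace (@gstep _ _ A) (ginit A) u /\ proj (lsig (A i)) u w.
Proof.
case: w => [w /fold_sound_fin[u]|g [rho [r0 H]]] /=.
  by rewrite /Stc /= St0 => ru <-; exists (WFin u).
have [||rho' [f [phi [h0 h1 h2 h3 h4]]]] :=
  @run_inf _ _ (@gstep _ _ A) vis (fun k => Stc (rho k)) g.
- by move=> k; have [] := fstep_run (H k).
- by move=> k; have [] := fstep_run (H k).
exists (WInf f); split; last by right; exists phi, g.
by exists rho'; rewrite h0 r0 /Stc St0.
Qed.

(** Converse of [reach_cfg]: the events of [C] are fired by increasing index. *)
Lemma cfg_reach C : cfg C ->
  exists2 M, Reach P M & forall c, M c <-> c.1 = top N C c.2.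
Proof.
move=> cC; pose D m : pred nat := fun x => C x && (x < m).
have cD m : cfg (D m).
  apply: (cfg_sub cC) => [x /andP[]//|x y /andP[Cy ym] xy].
  by rewrite /D (cfg_dc cC Cy xy) (ltn_trans (dep_lt gE xy) ym).
suff H m : m <= N -> exists2 M, Reach P M & forall c, M c <-> c.1 = top N (D m) c.2.
  have [M RM HM] := H N (leqnn _); exists M => // c; rewrite HM.
  by rewrite (@top_ext _ _ _ _ N (D N) C) // => y yN _; rewrite /D yN andbT.
elim: m => [|m IH] mN.
  exists (fun c => c.1 = None); first exact: Reach0.
  move=> c; rewrite (_ : top N _ _ = None) //; apply: istop_uniq.
  by move=> y _; rewrite /D ltn0 andbF.
have [M RM HM] := IH (ltnW mN).
case Cm: (C m); last first.
  exists M => // c; rewrite HM (@top_ext _ _ _ _ N (D m) (D m.+1)) // => y _ _.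
  by rewrite /D ltnS [y <= m]leq_eqVlt; case: eqP => // ->; rewrite Cm.
have := agree_some aP mN; case Em: (E m) => [e|//] _.
have bD y : D m y -> y < N by case/andP; lia.
have H j : part m j -> inn m j = top N (D m) j.
  move=> pm; apply: (cfg_next cC) => // [y /andP[]//|y z Dz yz||y iy].
  - exact: cfg_dc (cD m) Dz yz.
  - by rewrite /D ltnn andbF.
  - have ym : dep y m by exists j.
    by rewrite /D (cfg_dc cC Cm ym) (dep_lt gE ym).
eexists; first apply: (ReachS RM Em).
  move=> [o j] /andP[/= pe /eqP <-]; apply/HM => /=.
  by rewrite -H ?(part_E _ Em) // (inn_E _ Em).
have -> : D m.+1 = addc (D m) m.
  apply: funext => x; rewrite /D /addc ltnS [x <= m]leq_eqVlt.
  by case: eqP => [->|]; rewrite ?Cm.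
case=> o j /=; rewrite (top_add gE _ (cD m) bD H (leqnn _) mN) (part_E _ Em).
rewrite /preb /postb /=; have /= HMj := HM (_, j); split.
  move=> [[/HMj oe]|/andP[/eqP-> ->//]].
  case: ifP => //= pj; rewrite oe -H ?(part_E _ Em) //.
  by rewrite (inn_E _ Em) eqxx.
case: ifP => pj /= ->; first by right; rewrite eqxx.
by left; split=> //; apply/HMj.
Qed.

Hypothesis term : terminal (P, co, coc).

(** If no event of [P] realised this step at the cut of [C], the corresponding new event would be
    eligible, against termination. *)
Lemma next_event C a g : cfg C -> (forall x, C x -> ~ co x /\ ~ coc x) ->
  gstep (St C) a g ->
  exists k e, [/\ E k = Some e, ev_act e = a,
    forall j, part k j -> inn k j = top N C j & g = St (addc C k)].
Proof.
move=> cC gC [f [gt Hf]]; have bC y : C y -> y < N by apply: cfg_lt.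
pose e := Build_Event a f (fun j => top N C j).
have [k [e' [Ek [ea [et ei]]]]] : exists k e', E k = Some e' /\ ev_act e' = ev_act e /\
    (forall j, ev_tr e' j = ev_tr e j) /\
    (forall j, isSome (ev_tr e j) -> ev_in e' j = ev_in e j).
  apply: contrapT => nodup; apply: term; exists e.
  have pe : poss_ext P e.
    split=> //; split; last split=> //.
      move=> j p /= fj; have := Hf j; rewrite fj => -[Stj _]; split.
        case Et: (top N C j) => [x|]; [right|by left].
        by exists x; have [xN _ px] := topS Et; rewrite (agree_part _ aP).
      rewrite (agree_lab _ aP) // => x Et; by have [] := topS Et.
    have [M RM HM] := cfg_reach cC; exists M; split=> // j _.
    exact/HM.
  split=> // -[k [hk lek]].
  have [kN nd] : k < N /\ forall y, ~ dep k y by case: invP => _ H _ _; apply: H.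
  have g' := bp_grow (bpS bP pe).
  have sP : N < size (rcons P e) by rewrite size_rcons.
  (* A blocking cause [k] has a direct successor [z]. If [z] is the new event, then [k] lies in [C],
     which avoids [co] and [coc]; if [z] is old, the invariant forbids it. *)
  move: lek => /(le_nP g' (fun x _ => erefl) _ sP)/cle_invl[kE|[z kz zN]]; first by lia.
  have := cle_leq g' zN; rewrite leq_eqVlt => /orP[/eqP zE|zN'].
    case: kz => j; rewrite zE (inn_E _ (onth_rcons_last P e)) => -[_ /topS[_ Ck _]].
    by case: (gC _ Ck); case: hk.
  by apply: (nd z); apply: dep_ext kz; rewrite (@agree_rcons _ _ _ P e).
have H j : part k j -> inn k j = top N C j.
  by rewrite (part_E _ Ek) (inn_E _ Ek) et => /ei ->.
have [kN _] := agree_lt aP Ek.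
exists k, e'; split=> //.
apply: functional_extensionality_dep => j.
rewrite /St (top_add gE _ cC bC H (leqnn _) kN) (part_E _ Ek) et /=.
have := Hf j; case Ef: (f j) => [p|] //= [_ ->].
by rewrite Ek et /= Ef.
Qed.

(** A companion has a smaller index, so following companions ends at a non-cut-off. *)
Lemma rep_noncut k : co k -> exists k', [/\ ~ co k', k' < N, part k' i,
  St (past k) = St (past k') & fold_eq i P co (Some k', i) (Some k, i)].
Proof.
have [m] := ubnP k; elim: m k => // m IH k km ck.
have [kN pk] := co_part ck.
have [_ [k' cmp]] : cutoff i P k by case: invP => _ _ H _; apply: H.
have [kk' pk' _] := (companionP gE aP _ _ kN).1 cmp.
have kN' : k' < N by lia.
have eq1 := companion_St kN cmp.
have f1 : fold_eq i P co (Some k', i) (Some k, i).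
  apply: rst_sym; apply: rst_step; exists k, k'.
  by rewrite !(MarkP gE aP) // !tp_part.
have [ck'|nck'] := pselect (co k'); last by exists k'.
have [|k2 [h1 h2 h3 h4 h5]] := IH k' _ ck'; first by lia.
exists k2; split=> //; first by rewrite eq1.
exact: rst_trans h5 f1.
Qed.

(* A cut-off candidate k in the configuration C is skipped: its strong cause
   k' takes its place without changing the global state. *)
Lemma candidate_jump C o k : cfg C -> C k -> (forall x, pasto o x -> C x) ->
  top N C i = o -> coc k -> ~~ pasto o k -> (forall x, o = Some x -> ~ co x) ->
  exists k', [/\ k' <> k, cle k' k &
    St (fun x => past k x || pasto o x) = St (fun x => past k' x || pasto o x)].
Proof.
move=> cC Ck oC toC cck nok noco.
have kN : k < N by apply: cfg_lt cC Ck.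
have := let: And4 _ _ _ cand := invP in cand _ cck.
move=> /(candidateP gE aP _ _ kN)[npk [k' [kN' [ne k'k str] ss ip con]]].
exists k'; split=> //.
(* If [e0] is below [k], it is the last [i]-event of [[k]], and equality of [ip] puts it below [k'].
   Otherwise [e0] is concurrent with [k], both lying in [C], and the inclusion of the [Con] sets
   makes it concurrent with [k']. *)
have caseA : (exists e0, [/\ o = Some e0, ~ cle e0 k & ~ cle k' e0]) \/
    (forall x, pasto o x -> past k' x).
  case Eo: o => [e0|]; last by right.
  rewrite Eo in oC toC nok noco; have [e0N Ce0 pe0] := topS toC.
  have [e0k|ne0k] := pselect (cle e0 k).
    right=> x /= xe0; apply: past_le ((pastP E x e0).1 xe0); apply/pastP.
    suff : tp k i = Some e0 by rewrite ip => /tpS[].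
    apply: istop_uniq; split=> //; first by have := cle_leq gE e0k; lia.
      exact/pastP.
    move=> y _ /pastP yk py; have Cy := cfg_le cC Ck yk.
    have := topP E N C i; rewrite toC => -[_ _ _]; apply=> //.
    exact: cfg_lt cC Cy.
  left; exists e0; split=> //.
  have [|_ //] := con e0 e0N pe0 (noco _ erefl).
  split=> //; first by move=> /pastP; apply/negP.
  move=> [c [k1 [k2 [nk [p1 i1] [p2 i2] l1 l2]]]]; apply: nk.
  apply: (cfg_cf gE cC (cfg_le cC Ce0 l1) (cfg_le cC Ck l2) p1 p2).
  by rewrite i1 i2.
have disj f : past k f -> pasto o f -> past k' f.
  case: caseA => [[e0 [Eo ne0k nk'e0]]|H _]; last exact: H.
  rewrite Eo /= => /pastP fk /pastP fe0; apply/pastP; apply: contrapT => nfk'.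
  have Ce0 : C e0 by apply: oC; rewrite Eo /=; apply: past_refl.
  (* The path from [f] to [e0] leaves [[k]] by a step from [u] to [v] along [j]. Then [u] is the
     last [j]-event of [[k]], and its output belongs to M(k) but not to M(k'). *)
  have [||u [v [fu [j [pv iv]] ve0 uk nvk]]] := cle_cross (Q := fun x => ~ cle x k) fe0.
  - by apply.
  - by [].
  move/contrapT: uk => uk.
  have Cv := cfg_le cC Ce0 ve0.
  have [uv pu] := inn_lt gE pv iv.
  have tk : tp k j = Some u.
    apply: istop_uniq; split=> //; first by have := cle_leq gE uk; lia.
      exact/pastP.
    move=> y _ /pastP yk py; have Cy := cfg_le cC Ck yk.
    rewrite leqNgt; apply/negP => uy.
    have [yv|vy] := ltnP y v.
      have [_ /(_ _ pv)] := cC _ Cv; rewrite iv => /esym tv.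
      by have := topP E v C j; rewrite tv => -[_ _ _ /(_ _ yv Cy py)]; lia.
    by apply: nvk; apply: cle_trans (cfg_line cC Cv Cy pv py vy) yk.
  have tk' : tp k j <> tp k' j.
    rewrite tk => /esym/tpS[uk' _]; apply: nfk'; exact: cle_trans fu uk'.
  (* Conversely, a direct successor [x] of [k'] below [k] consumes an output of [k'], which thus
     belongs to M(k') but not to M(k). *)
  have [//|[x [j' [px ix]] xk]] := cle_invl k'k.
  have [k'x pk'] := inn_lt gE px ix.
  have tj' : tp k' j' <> tp k j'.
    rewrite tp_part //; have xk' : x < k.+1 by have := cle_leq gE xk; lia.
    have [t Et xt] := top_max xk' ((pastP E x k).2 xk) px.
    by rewrite /tp Et => -[]; lia.
  (* The strong cause condition now places [k'] below [u], hence below [e0], a contradiction. *)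
  have [a [b [[pa ia] ab [/= bE pb]]]] := str j j' tk' tj'.
  rewrite /= tp_part // in ia; rewrite tk in bE; case: bE => ?; subst b.
  apply: nk'e0; apply: cle_trans ve0; apply: cle_trans (cle_dep _).
    apply: cle_trans ab; apply: cle_dep; by exists j'.
  by exists j.
apply: functional_extensionality_dep => j; rewrite /St.
have kC x : past k x -> C x by move/pastP; apply: cfg_le cC Ck.
have k'k' x : past k' x -> past k x by move/pastP=> xk; apply/pastP; apply: cle_trans xk k'k.
(* If some [j]-event of [pasto o] is outside [[k]], the last [j]-event of both unions lies in
   [pasto o]. Otherwise the [j]-events of [pasto o] are in [[k]], hence in [[k']] by [disj], and
   equality of the states of [k] and [k'] concludes. *)
have [[z [zo nzk pz]]|nz] :=
  pselect (exists z, [/\ pasto o z, ~~ past k z & part z j]).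
  congr (lab _ j); apply/esym/istop_uniq.
  have zN : z < N by apply: cfg_lt cC _; apply: oC.
  have [t Et zt] := @top_max _ _ _ E N (fun x => past k x || pasto o x) j z zN
    (introT orP (or_intror zo)) pz.
  have := topP E N (fun x => past k x || pasto o x) j; rewrite Et => -[tN Ct pt T].
  have Cz : C z by apply: oC.
  have Ct' : C t by case/orP: Ct => [/kC|/oC].
  have zt' := cfg_line cC Cz Ct' pz pt zt.
  split=> //.
    case/orP: Ct => [tk|->]; last by rewrite orbT.
    by rewrite (past_le tk zt') in nzk.
  by move=> y yN /orP[/k'k' yk|yo] py; apply: T => //; rewrite ?yk ?yo ?orbT.
have zk z : part z j -> pasto o z -> past k z.
  by move=> pz zo; apply/negPn/negP => nzk; apply: nz; exists z.
rewrite (@top_ext _ _ _ _ N _ (past k)); last first.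
  by move=> y _ py; case: (boolP (pasto o y)) => [/(zk _ py)->|_]; rewrite ?orbF.
rewrite (@top_ext _ _ _ _ N (fun x => past k' x || _) (past k')); last first.
  move=> y _ py; case: (boolP (pasto o y)) => [yo|_]; rewrite ?orbF //.
  by rewrite (disj y) // zk.
by rewrite !(tp_top gE).
Qed.

End Summary.

(** * Pigeonhole on unbounded sets of indices *)

Definition unbounded (Q : nat -> Prop) := forall m, exists2 k, m <= k & Q k.

Lemma unbounded_pigeonhole (T : finType) (Q : nat -> Prop) (f : nat -> T) :
  unbounded Q -> exists v, unbounded (fun k => Q k /\ f k = v).
Proof.
move=> uQ; apply: contrapT => H.
have {}H v : exists m, forall k, m <= k -> ~ (Q k /\ f k = v).
  apply: contrapT => Hv; apply: H; exists v => m; apply: contrapT => Hm.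
  by apply: Hv; exists m => k mk QK; apply: Hm; exists k.
have [b Hb] := choice H.
have [k mk Qk] := uQ (\max_v b v).
by apply: (Hb (f k) k) => //; apply: leq_trans mk; apply: leq_bigmax.
Qed.

Lemma unbounded_pigeonhole_nat (Q : nat -> Prop) (f : nat -> nat) b :
  unbounded Q -> (forall k, Q k -> f k < b) ->
  exists v, unbounded (fun k => Q k /\ f k = v).
Proof.
move=> uQ fb; have [v Hv] := @unbounded_pigeonhole 'I_b.+1 Q (fun k => inord (f k)) uQ.
exists v => m; have [k mk [Qk fk]] := Hv m; exists k => //; split=> //.
by rewrite -fk inordK //; have := fb k Qk; lia.
Qed.

Lemma filter_enum (T : Type) (p : pred T) f (phi : nat -> nat) (g : nat -> T) K :
  (forall k, phi k < phi k.+1) -> (forall m, p (f m) <-> exists k, phi k = m) ->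
  (forall k, g k = f (phi k)) ->
  [seq a <- mkseq f (phi K) | p a] = mkseq g K.
Proof.
move=> mono vis gf.
have mono' k k' : k < k' -> phi k < phi k'.
  elim: k' => // k' IH; rewrite ltnS leq_eqVlt => /orP[/eqP->//|/IH h].
  exact: ltn_trans h (mono _).
have phi_lt k k' : (k < k') = (phi k < phi k').
  case: (ltngtP k k') => [/mono'->//|/mono'|->]; last by rewrite ltnn.
  by case: ltngtP.
(* Generalised to prefixes of any length [m], with [L] the number of visible positions below [m]. *)
suff H m L : (forall k, (k < L) = (phi k < m)) -> [seq a <- mkseq f m | p a] = mkseq g L.
  by apply: H => k; apply: phi_lt.
elim: m L => [|m IH] L HL; first by case: L HL => // L /(_ 0).
rewrite mkseqS filter_rcons; case: ifP => [/vis[k kE]|npm].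
  have kL : k < L by rewrite HL kE.
  have Lk : L <= k.+1 by rewrite leqNgt HL; have := mono k; lia.
  have -> : L = k.+1 by lia.
  by rewrite mkseqS gf kE (IH k) // => k'; rewrite phi_lt kE.
apply: IH => k; rewrite HL ltnS leq_eqVlt; case: eqP => // kE.
by rewrite (_ : p (f m)) in npm; last by apply/vis; exists k.
Qed.

(** * Completeness of the folding *)

Section Completeness.
Variables (Act : finType) (n : nat) (A : 'I_n -> LTS Act) (i : 'I_n).
Variables (P : seq (Event A)) (co coc : nat -> Prop).
Hypothesis invP : alg_inv i (P, co, coc).
Hypothesis term : terminal (P, co, coc).
Implicit Types (C D : pred nat) (j : 'I_n) (k x y z : nat).

Local Notation E := (onth P).
Local Notation N := (size P).
Local Notation part := (part E).
Local Notation inn := (inn E).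
Local Notation cle := (cle E).
Local Notation dep := (dep E).
Local Notation top := (top E).
Local Notation past := (past E).
Local Notation cfg := (cfg E).
Local Notation St := (St P).
Local Notation pasto := (pasto P).
Local Notation vis := (fun a => a \in lsig (A i)).

Let bP : bp P. Proof. by case: invP. Qed.
Let gE : grow E := bp_grow bP.
Let aP : agree E P := fun x _ => erefl.

(** Counts the events that may have to be replayed when the configuration of the last [i]-event is
    exchanged for another one. *)
Definition excess C o := count (fun x => C x && ~~ pasto o x) (iota 0 N).

(** Proper causes have successors, which events of [co] and [coc] lack; and [k] itself is an
    [i]-event, so no candidate. *)
Lemma past_noncut k : k < N -> part k i -> ~ co k ->
  forall x, past k x -> ~ co x /\ ~ coc x.
Proof.
case: invP => _ succ _ cand kN pk nck x /pastP/cle_invl[->|[y xy _]].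
  split=> // /cand[]; by rewrite (agree_part _ aP) // pk.
by split=> h; [have [] := succ x (or_introl h)|have [] := succ x (or_intror h)] => _ /(_ y).
Qed.

Lemma line_top C k x : cfg C -> C x -> part x i -> top N C i = Some k -> past k x.
Proof.
move=> cC Cx px tC; have := topP E N C i; rewrite tC => -[kN Ck pk T].
apply/pastP; apply: (cfg_line cC Cx Ck px pk).
by apply: T => //; apply: cfg_lt cC Cx.
Qed.

(** The outer induction bounds [excess C o + size u], the inner one is on [u]. An ordinary silent
    step does not increase the sum and uses the inner hypothesis; visible steps and skipped
    candidates decrease it strictly. *)
Lemma fold_complete_from m o C u : cfg C -> (forall x, pasto o x -> C x) ->
  top N C i = o -> (forall x, C x -> ~ co x /\ ~ coc x) ->
  fin_run (@gstep _ _ A) (St C) u -> excess C o + size u < m ->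
  fin_run (fstep i P co) (o, i) [seq a <- u | vis a].
Proof.
elim: m o C u => // m IHm o C u; elim: u o C => [//|a u IHu] o C cC oC toC gC.
move=> [g [st ru]] bm.
have [k [e [Ek ea H gk]]] := next_event invP term cC gC st.
have bC y : C y -> y < N by apply: cfg_lt.
have Ek' : isSome (E k) by rewrite Ek.
have kN : k < N by rewrite -onthTE.
have nCk := add_new gE cC bC Ek' H.
have cC' := cfg_add gE cC bC Ek' H.
have tC' j := top_add gE j cC bC H (leqnn _) kN.
have C'k : addc C k k by rewrite /addc eqxx.
have cK := cfg_past gE Ek'.
have KC' x : past k x -> addc C k x by move/pastP; apply: cfg_le cC' C'k.
have va : (a \in lsig (A i)) = part k i by rewrite -ea (act_vis bP _ Ek).
rewrite gk in ru; rewrite /= va; case: ifP => pk.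
  have ik : inn k i = o by rewrite H.
  have stp b : fold_eq i P co b (Some k, i) -> fstep i P co (o, i) a b.
    move=> bk; exists (o, i), (Some k, i); split; last by split=> //; apply: rst_refl.
    by exists k, e; rewrite -(inn_E _ Ek) ik -(part_E _ Ek).
  have oK x : pasto o x -> past k x.
    case Eo: o ik => [y|//] ik /= /pastP xy; apply/pastP.
    by apply: cle_trans xy _; apply: cle_dep; exists i.
  have tK : top N (addc C k) i = Some k by rewrite tC' pk.
  have exc : excess (addc C k) (Some k) <= excess C o.
    apply: sub_count => x /andP[/orP[/eqP->|Cx] nx]; first by rewrite /= past_refl in nx.
    by rewrite Cx /=; apply: contra nx; apply: oK.
  (* For a cut-off, the replay restarts from the local configuration of a non-cut-off
     representative, of excess 0. The events of the current configuration outside [[k]] are silent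
     and are put back in front of [u]. *)
  have [ck|nck] := pselect (co k).
    have [k' [nck' kN' pk' eSt feq]] := rep_noncut invP ck.
    exists (Some k', i); split; first exact: stp.
    have -> : [seq a <- u | vis a] =
        [seq a <- labs P (past k) (addc C k) ++ u | vis a].
      rewrite filter_cat [X in X ++ _]filter_invis //; apply: (labs_invis bP) => x Cx.
      by apply: contra => px; apply: line_top cC' Cx px tK.
    have Ek'' : isSome (E k') by rewrite onthTE.
    apply: (IHm _ (past k')) => //.
    - exact: cfg_past.
    - by rewrite (tp_top gE) // tp_part.
    - exact: past_noncut.
    - rewrite -eSt; apply: fin_run_cat ru; exact: run_cfg.
    - rewrite size_cat; have := size_labs P (past k) (addc C k).
      have -> : excess (past k') (Some k') = 0.
        by apply/eqP; rewrite eqn0Ngt -has_count; apply/hasPn => x _; rewrite /= andbN.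
      rewrite -/(excess (addc C k) (Some k)); move: bm => /=; lia.
  exists (Some k, i); split; first by apply: stp; apply: rst_refl.
  apply: (IHm _ (addc C k)) => //; last by move: bm => /=; lia.
  move=> x /orP[/eqP->|/gC//]; split=> // cck.
  case: invP => _ _ _ /(_ _ cck)[]; by rewrite (agree_part _ aP) // pk.
have oC' x : pasto o x -> addc C k x by move/oC => Cx; rewrite /addc Cx orbT.
have toC' : top N (addc C k) i = o by rewrite tC' pk.
have nok : ~~ pasto o k by apply: contra nCk; apply: oC.
have nck : ~ co k by move/(co_part invP)=> [_]; rewrite pk.
have [cck|ncck] := pselect (coc k); last first.
  apply: (IHu _ (addc C k)) => //; first by move=> x /orP[/eqP->|/gC].
  have : excess (addc C k) o <= count_mem k (iota 0 N) + excess C o.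
    rewrite /excess; elim: (iota 0 N) => //= x s; rewrite /addc.
    by case: (x == k); case: (C x); case: (pasto o x) => /=; lia.
  by rewrite count_uniq_mem ?iota_uniq //; move: bm => /=; case: (_ \in _); lia.
have oco x : o = Some x -> ~ co x.
  by move=> ox; have [_ Cx _] := topS (etrans toC ox); have [] := gC x Cx.
have [k' [ne k'k eSt]] := candidate_jump invP cC' C'k oC' toC' cck nok oco.
have dco x y : pasto o y -> dep x y -> pasto o x.
  by case: o {toC oC IHu bm oC' toC' nok oco eSt} => //= z; apply: past_dc.
have subcfg z : cle z k -> cfg (fun x => past z x || pasto o x).
  move=> zk; apply: (cfg_sub cC') => [x /orP[/pastP xz|/oC'//]|x y].
    by apply: KC'; apply/pastP; apply: cle_trans xz zk.
  by case/orP=> [/past_dc h|/dco h] /h ->; rewrite ?orbT.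
have k'N : k' < N by have := cle_leq gE k'k; lia.
have nk'k : ~~ past k' k.
  by apply/negP => /pastP kk'; exact: ne (cle_anti gE k'k kk').
(* [C0] and [C1] have the same global state by [candidate_jump]; the replay moves to [C1], and the
   events outside [C0], all silent, are prepended to [u]. *)
set C0 : pred nat := fun x => past k x || pasto o x.
set C1 : pred nat := fun x => past k' x || pasto o x.
have C10 x : C1 x -> C0 x.
  case/orP=> [/pastP xk'|xo]; apply/orP; [left|right] => //.
  by apply/pastP; apply: cle_trans xk' k'k.
have C0C' x : C0 x -> addc C k x by case/orP=> [/KC'|/oC'].
have nC1 : ~~ C1 k by rewrite /C1 negb_or nk'k.
have C1C x : C1 x -> C x.
  move=> C1x; have /C10/C0C'/orP[/eqP xk|//] := C1x.
  by rewrite -xk C1x in nC1.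
have inv_i x : addc C k x -> ~~ C0 x -> ~~ part x i.
  move=> Cx; apply: contra => px; apply/orP; right.
  case Eo: o toC' => [y|] t; first exact: line_top cC' Cx px t.
  have := topP E N (addc C k) i; rewrite t => /(_ x (cfg_lt cC' Cx) Cx px) [].
have -> : [seq a <- u | vis a] = [seq a <- labs P C0 (addc C k) ++ u | vis a].
  by rewrite filter_cat [X in X ++ _]filter_invis //; apply: (labs_invis bP).
apply: (IHm _ C1) => //.
- exact: subcfg.
- by move=> x xo; rewrite /C1 xo orbT.
- apply: istop_uniq; have := topP E N C i; rewrite toC.
  case Eo: o => [y|] /=; last by move=> T x xN /C1C; apply: T.
  move=> [yN Cy py T]; split=> //; last by move=> x xN /C1C; apply: T.
  by rewrite /C1 Eo /= past_refl orbT.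
- by move=> x /C1C/gC.
- rewrite -eSt; apply: fin_run_cat ru; apply: run_cfg => //.
  exact: subcfg (cle_refl _ _).
(* The two sets counted on the left are disjoint and avoid [k], so the prepended events are paid for
   by the excess, and the consumed letter [a] makes the decrease strict. *)
- have : excess C1 o + count (fun x => addc C k x && ~~ C0 x) (iota 0 N) <= excess C o.
    apply: count_disjoint => x.
    + by case/andP=> /C1C -> ->.
    + case/andP=> /orP[/eqP->|Cx]; rewrite negb_or; first by rewrite past_refl.
      by rewrite Cx => /andP[].
    + by case/andP=> /C10 -> _ /andP[].
  have := size_labs P C0 (addc C k); rewrite size_cat; move: bm => /=; lia.
Qed.

Lemma fold_complete_fin u : fin_run (@gstep _ _ A) (ginit A) u ->
  fin_run (fstep i P co) (fold_init i) [seq a <- u | vis a].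
Proof.
move=> ru; apply: (@fold_complete_from (excess pred0 None + size u).+1 None pred0) => //.
  by apply: istop_uniq.
by rewrite St0.
Qed.

Lemma fin_run_fold_eq b b' w : fold_eq i P co b b' ->
  fin_run (fstep i P co) b w -> fin_run (fstep i P co) b' w.
Proof.
move=> bb'; case: w => //= a w [b1 [[c [c' [st [bc bc']]]] r]]; exists b1; split=> //.
exists c, c'; split=> //; split=> //; apply: rst_trans bc; exact: rst_sym.
Qed.

(* Koenig's lemma: up to folding, S_i has finitely many states. *)
Lemma fold_inf g : (forall L, fin_run (fstep i P co) (fold_init i) (mkseq g L)) ->
  is_trace (fstep i P co) (fold_init i) (WInf g).
Proof.
move=> H; pose good k b := forall L, fin_run (fstep i P co) b (map g (iota k L)).
have good_step kb : exists b', good kb.1 kb.2 ->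
    fstep i P co kb.2 (g kb.1) b' /\ good kb.1.+1 b'.
  case: kb => k b /=; case: (pselect (good k b)) => [gb|]; last by exists b.
  have step1 L : exists x, [/\ x < N, fstep i P co b (g k) (Some x, i) &
      fin_run (fstep i P co) (Some x, i) (map g (iota k.+1 L))].
    have [b1 [[c [c' [st [bc b1c']]]] r]] := gb L.+1.
    have [x [e [Ex [_ [_ [_ c'E]]]]]] := st; exists x; rewrite -c'E.
    have [xN _] := agree_lt aP Ex; split=> //; last exact: fin_run_fold_eq r.
    by exists c, c'; split=> //; split=> //; apply: rst_refl.
  have [f Hf] := choice step1.
  (* One successor [x] works for infinitely many lengths, hence for all of them by taking
     prefixes. *)
  have [||x Hx] := @unbounded_pigeonhole_nat (fun _ => True) f N.
  - by move=> m; exists m.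
  - by move=> L _; have [] := Hf L.
  exists (Some x, i) => _; split.
    by have [L _ [_ <-]] := Hx 0; have [] := Hf L.
  move=> L; have [L' LL' [_ <-]] := Hx L; have [_ _] := Hf L'.
  by rewrite -(subnKC LL') iotaD map_cat; apply: fin_run_prefix.
have [F HF] := choice good_step.
pose rho := fix rho k := if k is k'.+1 then F (k', rho k') else fold_init i.
have good_rho k : good k (rho k).
  elim: k => [L|k IH] /=; first exact: H.
  by have [] := HF (k, rho k) IH.
exists rho; split=> // k; by have [] := HF (k, rho k) (good_rho k).
Qed.

Lemma fold_complete u w : is_trace (@gstep _ _ A) (ginit A) u -> proj (lsig (A i)) u w ->
  is_trace (fstep i P co) (fold_init i) w.
Proof.
case: u => [u /fold_complete_fin H ->//|f [rho [r0 Hr]]].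
have fin M : fin_run (fstep i P co) (fold_init i) [seq a <- mkseq f M | vis a].
  by apply: fold_complete_fin; rewrite -r0; apply: fin_run_inf.
case=> [[M [_ ->]]|[phi [g [-> [mono [vf gf]]]]]]; first exact: fin.
by apply: fold_inf => L; rewrite -(filter_enum (p := vis) L mono vf gf); apply: fin.
Qed.

End Completeness.

Lemma not_unbounded Q : ~ unbounded Q -> exists b, forall x, b <= x -> ~ Q x.
Proof.
move=> nu; apply: contrapT => H; apply: nu => m; apply: contrapT => Hm.
by apply: H; exists m => x mx Qx; apply: Hm; exists x.
Qed.

(** * Infinite processes and their infinite causal chains *)

Section Chain.
Variables (Act : finType) (n : nat) (A : 'I_n -> LTS Act).
Variable E : nat -> option (Event A).
Hypothesis gE : grow E.
Implicit Types (j : 'I_n) (k x y z d m : nat).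

Local Notation part := (part E).
Local Notation inn := (inn E).
Local Notation cle := (cle E).
Local Notation dep := (dep E).
Local Notation past := (past E).
Local Notation tp := (tp E).
Local Notation lab := (lab E).

(** The causal chains ending in [y] have at most [d] events, [y] included; hence [False] for
    [d = 0]. *)
Fixpoint depth_le d y : Prop :=
  if d is d'.+1 then forall x, dep x y -> depth_le d' x else False.

Definition level d y := depth_le d.+1 y /\ ~ depth_le d y.

Lemma no_duplicate k k' e e' : E k = Some e -> E k' = Some e' ->
  ev_act e = ev_act e' -> (forall j, ev_tr e j = ev_tr e' j) ->
  (forall j, part k' j -> ev_in e j = ev_in e' j) -> k < k' -> False.
Proof.
move=> Ek Ek' ea et ei kk'; have [P [_ sP aP [_ [_ [_ nd]]]]] := gE Ek'.
apply: nd; exists k, e; rewrite aP ?sP //; do !split=> //.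
by move=> j; rewrite -(part_E _ Ek') => /ei.
Qed.

(** A finite code for events, faithful when all inputs are produced by events of index below [b],
    where [inord] is injective. *)
Definition event_code b k :
  option Act * {dffun forall j, option (lst (A j) * lst (A j))} *
  {ffun 'I_n -> option 'I_b.+1} :=
  (omap (@ev_act _ _ A) (E k),
   [ffun j => if E k is Some e then ev_tr e j else None],
   [ffun j => if part k j then omap inord (inn k j) else None]).

Hypothesis totE : forall k, isSome (E k).

(* An event is determined by its label and its inputs. *)
Lemma depth_le_bounded d : exists b, forall y, depth_le d y -> y < b.
Proof.
elim: d => [|d [b IH]]; first by exists 0.
suff : ~ unbounded (depth_le d.+1).
  move/not_unbounded=> [b' Hb']; exists b' => y dy.
  by rewrite ltnNge; apply/negP => /Hb'.
move=> /(unbounded_pigeonhole (event_code b))[v Hv].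
have [y1 _ [d1 c1]] := Hv 0; have [y2 y12 [d2 c2]] := Hv y1.+1.
have {c1 c2} := etrans c1 (esym c2).
have := totE y1; have := totE y2; rewrite /event_code.
case E2: (E y2) => [e2|//] _; case E1: (E y1) => [e1|//] _ [ea /ffunP et /ffunP ei].
have {}et j : ev_tr e1 j = ev_tr e2 j by have := et j; rewrite !ffunE.
apply: (no_duplicate E1 E2 ea et) y12 => j p2; have := ei j.
have p1 : part y1 j by move: p2; rewrite (part_E _ E2) (part_E _ E1) et.
have b1 x : ev_in e1 j = Some x -> x < b by move=> h; apply/IH/d1; exists j; rewrite (inn_E _ E1).
have b2 x : ev_in e2 j = Some x -> x < b by move=> h; apply/IH/d2; exists j; rewrite (inn_E _ E2).
rewrite !ffunE p1 p2 (inn_E _ E1) (inn_E _ E2).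
case I1: (ev_in e1 j) b1 => [x1|]; case I2: (ev_in e2 j) b2 => [x2|] //= b2 b1 [].
move/(congr1 val); rewrite /= !inordK => [->//||].
  by have := b2 _ erefl; lia.
by have := b1 _ erefl; lia.
Qed.

(** Take the event of least index and depth above [d]: its causes have smaller indices, so depth at
    most [d]. *)
Lemma level_ex d : exists y, level d y.
Proof.
have [b Hb] := depth_le_bounded d.
have ex : exists y, `[<~ depth_le d y>] by exists b; apply/asboolP => /Hb; rewrite ltnn.
case: (ex_minnP ex) => y /asboolP ny ymin; exists y; split=> // x xy.
apply: contrapT => nx; have := ymin x; rewrite (asboolT nx) => /(_ isT).
by have := dep_lt gE xy; lia.
Qed.

Lemma level_parent d y : level d.+1 y -> exists2 x, dep x y & level d x.
Proof.
move=> [h nh]; apply: contrapT => H; apply: nh => x xy; apply: contrapT => nx.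
by apply: H; exists x => //; split=> //; apply: h.
Qed.

Lemma level_path m y : level m y -> exists p : nat -> nat,
  [/\ p m = y, forall d, d <= m -> level d (p d) & forall d, d < m -> dep (p d) (p d.+1)].
Proof.
elim: m y => [|m IH] y ly.
  by exists (fun _ => y); split=> // d; rewrite leqn0 => /eqP->.
have [x xy /IH[p [px pl pd]]] := level_parent ly.
exists (fun d => if d == m.+1 then y else p d); split=> [|d|d]; first by rewrite eqxx.
  by rewrite leq_eqVlt; case: eqP => [->//|_ /= dm]; apply: pl.
rewrite ltnS leq_eqVlt eqSS => /orP[/eqP->|dm]; first by rewrite eqxx px ltn_eqF.
by rewrite !ltn_eqF //; [apply: pd|lia].
Qed.

(** Koenig's lemma by levels, since an event may have infinitely many successors whereas each level
    is finite. [Qs d] is an infinite set of paths that agree with the chain on its first [d]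
    entries. *)
Lemma infinite_chain : exists c : nat -> nat, forall d, dep (c d) (c d.+1).
Proof.
have ex m : exists p : nat -> nat, (forall d, d <= m -> level d (p d)) /\
    forall d, d < m -> dep (p d) (p d.+1).
  by have [y /level_path[p [_ h1 h2]]] := level_ex m; exists p.
have [p Hp] := choice ex.
have pick (dQ : nat * (nat -> Prop)) : exists v, unbounded dQ.2 ->
    unbounded (fun m => dQ.2 m /\ p m dQ.1 = v).
  case: dQ => d Q /=; case: (pselect (unbounded Q)) => [uQ|]; last by exists 0.
  have [b Hb] := depth_le_bounded d.+1.
  have [||v Hv] := @unbounded_pigeonhole_nat (fun m => Q m /\ d <= m) (fun m => p m d) b.
  - move=> m; have [k mk Qk] := uQ (maxn m d); exists k; first by lia.
    by split=> //; lia.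
  - by move=> m [_ dm]; apply: Hb; have [/(_ d dm)[]] := Hp m.
  by exists v => _ m; have [k mk [[Qk _] kv]] := Hv m; exists k.
have [G HG] := choice pick.
pose Qs := fix Qs d : nat -> Prop :=
  if d is d'.+1 then fun m => Qs d' m /\ p m d' = G (d', Qs d') else fun _ => True.
have uQs d : unbounded (Qs d).
  by elim: d => [m|d IH]; [exists m|exact: (HG (d, Qs d) IH)].
exists (fun d => G (d, Qs d)) => d.
(* A single path goes through both entries [d] and [d.+1] of the chain; the bound [d < m] makes it
   long enough. *)
have [m dm [[_ h1] h2]] := uQs d.+2 d.+1.
by have [_ /(_ d dm)] := Hp m; rewrite h1 h2.
Qed.

Section AlongChain.
Variable c : nat -> nat.
Hypothesis Hc : forall d, dep (c d) (c d.+1).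

Definition below x := exists l, cle x (c l).

Lemma chain_cle k l : k <= l -> cle (c k) (c l).
Proof.
move/subnKC <-; elim: (l - k) => [|t IH]; first by rewrite addn0; apply: cle_refl.
by rewrite addnS; apply: cle_trans IH (cle_dep _).
Qed.

Lemma chain_lt k l : k < l -> c k < c l.
Proof. by move=> kl; apply: leq_trans (dep_lt gE (Hc k)) (cle_leq gE (chain_cle kl)). Qed.

Lemma chain_ge k : k <= c k.
Proof. by elim: k => // k IH; apply: leq_ltn_trans IH (chain_lt (ltnSn k)). Qed.

Lemma below_chain l : below (c l). Proof. by exists l; apply: cle_refl. Qed.

Lemma below_bound b : exists K, forall x, x < b -> below x -> cle x (c K).
Proof.
elim: b => [|b [K IH]]; first by exists 0.
have [[l bl]|nb] := pselect (below b); last first.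
  by exists K => x; rewrite ltnS leq_eqVlt => /orP[/eqP->//|]; apply: IH.
exists (maxn K l) => x; rewrite ltnS leq_eqVlt => /orP[/eqP->|xb] bx.
  by apply: cle_trans bl (chain_cle _); lia.
by apply: cle_trans (IH x xb bx) (chain_cle _); lia.
Qed.

(* If f is not above c k, the path from f into the chain enters the future of
   c k by some g0 -> g along a component j, so f precedes every j-event above c k. *)
Lemma almost_all_above k : exists b, forall f, below f -> b <= f -> cle (c k) f.
Proof.
have ex j : exists w, (exists g, [/\ below g, part g j & cle (c k) g]) ->
    [/\ below w, part w j & cle (c k) w].
  case: (pselect (exists g, [/\ below g, part g j & cle (c k) g])) => [[g]|];
    by [exists g | exists 0].
have [w Hw] := choice ex.
exists (\max_j w j) => f [l fl] bf; apply: contrapT => nf.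
have fl' : cle f (c (maxn k l)) by apply: cle_trans fl (chain_cle (leq_maxr _ _)).
have [g0 [g [fg0 [j [pg ig]] gl ng0 kg]]] :=
  cle_cross (Q := fun x => cle (c k) x) fl' nf (chain_cle (leq_maxl _ _)).
have bg : below g by exists (maxn k l).
have [|[l' wl'] pw kw] := Hw j; first by exists g.
have [g0g pg0] := inn_lt gE pg ig.
pose M := maxn (maxn k l) l'.
have gM : cle g (c M) by apply: cle_trans gl (chain_cle (leq_maxl _ _)).
have wM : cle (w j) (c M) by apply: cle_trans wl' (chain_cle (leq_maxr _ _)).
have g0M : cle g0 (c M) by apply: cle_trans (cle_dep _) gM; exists j.
have [wg0|] := leqP (w j) g0.
  apply: ng0; apply: cle_trans kw _.
  by apply: (cfg_line (cfg_past gE (totE (c M))) _ _ pw pg0 wg0); apply/pastP.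
have : w j <= \max_j w j by apply: leq_bigmax.
by have := cle_leq gE fg0; lia.
Qed.

(** Beyond [K] the cut can change only on components with infinitely many events below the chain. On
    those, the condition of M(c k) is consumed below some [c k'], and for large [l] the condition of
    M(c l) is produced above [c k']. *)
Lemma chain_strong : exists K, forall k, K <= k -> exists L, forall l, L <= l ->
  strongE E (c k) (c l) /\
  forall j b, (forall x, below x -> part x j -> x < b) -> tp (c l) j = tp (c k) j.
Proof.
pose unb j := unbounded (fun x => below x /\ part x j).
have exb j : exists b, ~ unb j -> forall x, below x -> part x j -> x < b.
  case: (pselect (unb j)) => [|/not_unbounded[b Hb]]; first by exists 0.
  by exists b => _ x bx px; rewrite ltnNge; apply/negP => /Hb; apply.
have [b Hb] := choice exb.
have [K HK] := below_bound (\max_j b j).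
have stable j k l : ~ unb j -> K <= k -> K <= l -> tp (c k) j = tp (c l) j.
  move=> nu Kk Kl; pose M := (maxn (c k) (c l)).+1.
  rewrite -(tp_top gE (N := M)); last by rewrite /M; lia.
  rewrite -(tp_top gE (k := c l) (N := M)); last by rewrite /M; lia.
  have sub k1 k2 y : K <= k2 -> part y j -> past (c k1) y -> past (c k2) y.
    move=> K2 py /pastP yk; apply/pastP; apply: cle_trans (chain_cle K2).
    have by' : below y by exists k1.
    apply: HK => //; apply: leq_trans (Hb j nu y by' py) _; exact: leq_bigmax.
  by apply: top_ext => y _ py; apply/idP/idP; apply: sub.
exists K => k Kk.
(* For every such component, [xs] is an event of index above [c k], and [k'] is chosen with all of
   them below [c k']. Then [ys] is an event of index at least [B], and [L] puts all of these below
   the chain event. *)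
have exx m j : exists x, unb j -> [/\ below x, part x j & m <= x].
  case: (pselect (unb j)) => [|]; last by exists 0.
  by move=> /(_ m)[x mx [bx px]]; exists x.
have [xs Hxs] := choice (exx (c k).+1).
have [k' Hk'] := below_bound (\max_j xs j).+1.
have [B HB] := almost_all_above k'.
have [ys Hys] := choice (exx B).
have [L HL] := below_bound (\max_j ys j).+1.
exists (maxn L (maxn k.+1 K)) => l Ll.
have kl : k < l by lia.
have unbP j : tp (c l) j <> tp (c k) j -> unb j.
  by move=> h; apply: contrapT => nu; apply: h; apply: stable => //; lia.
split; last first.
  move=> j b0 Hb0; apply: contrapT => /unbP/(_ b0)[x bx [h1 h2]].
  by have := Hb0 x h1 h2; lia.
split; [by have := chain_lt kl; lia|by apply: chain_cle; lia|].
move=> j j' /unbP uj hj'; have uj' : unb j' by apply: unbP => /esym.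
have [by_ py By] := Hys j uj.
have yl : cle (ys j) (c l).
  apply: cle_trans (HL _ _ by_) (chain_cle _); last by lia.
  by rewrite ltnS; apply: leq_bigmax.
have yl' : ys j < (c l).+1 by have := cle_leq gE yl; lia.
have [t Et yt] := top_max yl' ((pastP E _ _).2 yl) py.
have [_ /pastP tl pt] := topS Et.
have k't : cle (c k') t by apply: HB; [exists l|lia].
have [bx px kx] := Hxs j' uj'.
have xk' : cle (xs j') (c k') by apply: Hk' => //; rewrite ltnS; apply: leq_bigmax.
have kk' : k <= k'.
  rewrite leqNgt; apply/negP => /ltnW/chain_cle/(cle_leq gE).
  by have := cle_leq gE xk'; lia.
have nx : ~~ past (c k) (xs j').
  by apply/negP => /(past_leq gE); lia.
(* [xs j'] lies in [[c k']] outside [[c k]], so the [j']-condition of M(c k) has a consumer [w]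
   below [c k'], hence below [t]. *)
have [w [/pastP wk' pw iw]] := @cfg_consume _ _ _ E gE (past (c k')) (past (c k)) (c k).+1 j'
  (xs j') (cfg_past gE (totE _))
  (fun y yk => (pastP E _ _).2 (cle_trans ((pastP E _ _).1 yk) (chain_cle kk')))
  (@past_dc _ _ _ _ _) (fun y yk => past_leq gE yk) ((pastP E _ _).2 xk') nx px.
exists w, t; split=> //.
exact: cle_trans wk' k't.
Qed.

End AlongChain.

Definition state_code k : {dffun forall j, lst (A j)} := [ffun j => lab (tp k j) j].

Lemma state_code_sst k k' : state_code k = state_code k' -> sst E k k'.
Proof. by move=> /ffunP H j; have := H j; rewrite !ffunE. Qed.

Lemma noncut_bounded i : exists b, forall x, b <= x -> part x i -> cutE E i x.
Proof.
have [|b Hb] := @not_unbounded (fun x => part x i /\ ~ cutE E i x).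
  move=> /(unbounded_pigeonhole state_code)[v Hv].
  have [x _ [[px ncx] cx]] := Hv 0; have [y xy [[py ncy] cy]] := Hv x.+1.
  apply: ncy; split=> //; exists x; split=> //; apply: state_code_sst.
  by rewrite cx cy.
by exists b => x bx px; apply: contrapT => nc; apply: (Hb x).
Qed.

End Chain.

(** * Absence of infinite runs *)

Section Termination.
Variables (Act : finType) (n : nat) (A : 'I_n -> LTS Act) (i : 'I_n).
Variable r : nat -> astate A.
Hypothesis r0 : r 0 = ainit A.
Hypothesis rS : forall k, astep i (r k) (r k.+1).

Let Nn k := (r k).1.1.
Let co k := (r k).1.2.
Let coc k := (r k).2.
(** The limit process of the run: step [k] adds the event of index [k], which stays unchanged
    afterwards. *)
Let E k := onth (Nn k.+1) k.

Lemma run_alg_inv k : alg_inv i (r k).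
Proof.
apply: alg_inv_reach; elim: k => [|k IH]; first by rewrite r0; apply: rt_refl.
exact: rt_trans IH (rt_step _ _ _ _ (rS k)).
Qed.

Lemma run_step k : exists e, [/\ Nn k.+1 = rcons (Nn k) e, poss_ext (Nn k) e,
  (forall x, co k x \/ coc k x -> ~ le_n (rcons (Nn k) e) (NE n x) (NE n (size (Nn k)))) &
  [\/ cutoff i (Nn k.+1) (size (Nn k)) /\ co k.+1 = (fun x => co k x \/ x = size (Nn k)) /\
        coc k.+1 = coc k,
      ~ cutoff i (Nn k.+1) (size (Nn k)) /\ candidate i (co k) (Nn k.+1) (size (Nn k)) /\
        co k.+1 = co k /\ coc k.+1 = (fun x => coc k x \/ x = size (Nn k))
    | ~ cutoff i (Nn k.+1) (size (Nn k)) /\ ~ candidate i (co k) (Nn k.+1) (size (Nn k)) /\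
        co k.+1 = co k /\ forall x, coc k x -> candidate i (co k) (Nn k.+1) x -> coc k.+1 x]].
Proof.
rewrite /Nn /co /coc; have := rS k; case: (r k) => [[N c] cc] [e [[pe el] H]]; exists e.
case: H => [[h ->]|[h [h' ->]]|[h [h' ->]]]; split=> //=.
all: try by move=> x hx le; apply: el; exists x.
- by constructor 1.
- by constructor 2.
by constructor 3; do !split=> //; case.
Qed.

Lemma size_Nn k : size (Nn k) = k.
Proof.
elim: k => [|k IH]; first by rewrite /Nn r0.
by have [e [-> _ _ _]] := run_step k; rewrite size_rcons IH.
Qed.

Lemma agree_Nn k : agree E (Nn k).
Proof.
elim: k => [|k IH] x; first by rewrite size_Nn.
rewrite size_Nn ltnS leq_eqVlt => /orP[/eqP->//|xk].
have [e [-> _ _ _]] := run_step k; rewrite onth_rcons size_Nn (ltn_eqF xk).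
by apply: IH; rewrite size_Nn.
Qed.

Lemma run_tot k : isSome (E k).
Proof. by rewrite /E onthTE size_Nn. Qed.

Lemma run_grow : grow E.
Proof.
move=> k e; rewrite /E; have [e' [-> pe _ _]] := run_step k.
rewrite -{2}(size_Nn k) onth_rcons_last => -[<-].
exists (Nn k); split=> //; [|exact: size_Nn|exact: agree_Nn].
by have := run_alg_inv k; rewrite /Nn; case: (r k) => [[N c] cc] [].
Qed.

(** Being a cut-off involves only the event and those of smaller index, so it is settled when the
    event is added. *)
Lemma run_co m x : co m x <-> (x < m /\ cutE E i x).
Proof.
elim: m => [|m IH]; first by rewrite /co r0; split=> // -[].
have mP : m < size (Nn m.+1) by rewrite size_Nn.
have [e [_ _ _]] := run_step m; rewrite size_Nn (propext (cutoffP run_grow (@agree_Nn _) _ mP)).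
case=> [[cm [-> _]]|[ncm [_ [-> _]]]|[ncm [_ [-> _]]]]; rewrite IH ltnS [x <= m]leq_eqVlt.
- split; first by move=> [[-> ?]|->]; rewrite ?eqxx ?orbT.
  by move=> [/orP[/eqP|] ? ?]; auto.
- by split=> [[-> ?]|[/orP[/eqP->|]]] //; rewrite orbT.
- by split=> [[-> ?]|[/orP[/eqP->|]]] //; rewrite orbT.
Qed.

Lemma run_noncause m x : co m x \/ coc m x -> ~ cle E x m.
Proof.
have [e [Ne _ H _]] := run_step m; move=> /H; rewrite -Ne size_Nn.
by rewrite (le_nP run_grow (@agree_Nn _)) // size_Nn.
Qed.

(** Freeing is considered only when the added event is not a cut-off, so candidacy of [x] has to be
    checked in that case alone. *)
Lemma coc_stay m x : x < m -> coc m x ->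
  (~ cutE E i m -> candE E i m.+1 (co m) x) -> coc m.+1 x.
Proof.
move=> xm cx H; have mP : m < size (Nn m.+1) by rewrite size_Nn.
have xP : x < size (Nn m.+1) by rewrite size_Nn; lia.
have [e [_ _ _]] := run_step m; rewrite size_Nn (propext (cutoffP run_grow (@agree_Nn _) _ mP)).
case=> [[cm [_ ->]//]|[ncm [_ [_ ->]]]|[ncm [_ [_ h]]]]; first by left.
apply: h => //; apply/(candidateP run_grow (@agree_Nn _)) => //.
by rewrite size_Nn; apply: H.
Qed.

Lemma coc_enter m : ~ cutE E i m -> candE E i m.+1 (co m) m -> coc m.+1 m.
Proof.
have mP : m < size (Nn m.+1) by rewrite size_Nn.
have [e [_ _ _]] := run_step m; rewrite size_Nn (propext (cutoffP run_grow (@agree_Nn _) _ mP)).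
rewrite (propext (candidateP run_grow (@agree_Nn _) _ _ mP)) size_Nn.
by case=> [[cm _]|[ncm [_ [_ ->]]]|[_ [nc _]]] // _ _; right.
Qed.

Lemma no_infinite_run : False.
Proof.
have gE := run_grow; have [c Hc] := infinite_chain gE run_tot.
have [b Hb] := noncut_bounded E i.
(* Every event below the chain is a cause of a later chain event, and so cannot be a cut-off. *)
have below_b x : below E c x -> part E x i -> x < b.
  move=> [l xl] px; rewrite ltnNge; apply/negP => bx.
  have cx := Hb x bx px.
  have xl1 : cle E x (c l.+1) by apply: cle_trans xl (cle_dep (Hc l)).
  apply: (@run_noncause (c l.+1) x) xl1; left; apply/run_co; split=> //.
  by apply: leq_ltn_trans (cle_leq gE xl) (dep_lt gE (Hc l)).
have [K HK] := chain_strong gE run_tot Hc.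
have uT : unbounded (fun _ => True) by move=> m; exists m.
have [v Hv] := unbounded_pigeonhole (fun k => state_code E (c k)) uT.
(* [K] is for the strong cause condition, and [b <= k] gives [b <= c k], so that no non-cut-off
   [i]-event is above [c k]. *)
have [k Kk [_ ck]] := Hv (maxn K b).
have [L HL] := HK k (leq_trans (leq_maxl _ _) Kk).
have [l Ll [_ cl]] := Hv (maxn L k.+1).
have [str ips] := HL l (leq_trans (leq_maxl _ _) Ll).
have kl : c k < c l by apply: (chain_lt gE Hc); lia.
have bk : b <= c k by have := chain_ge gE Hc k; lia.
have npl : ~~ part E (c l) i.
  by apply/negP => /(below_b _ (below_chain E c l)); lia.
have cand N (co' : nat -> Prop) : c k < N ->
    (forall x, x < N -> part E x i -> ~ co' x -> x < b) -> candE E i N co' (c l).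
  move=> kN H; split=> //; exists (c k); split=> //.
  - by apply: state_code_sst; rewrite ck cl.
  - exact: ips below_b.
  (* Since [c k] is below [c l], a causal path from [x] to [c k], or a conflict between them, would
     carry over to [c l]; and [x < b <= c k] excludes [c k] below [x]. *)
  move=> x xN px cox [h1 h2 h3]; have xb := H x xN px cox.
  have kl' : cle E (c k) (c l) by apply: chain_cle => //; lia.
  split.
  - by move=> xk; apply: h1; apply: cle_trans xk kl'.
  - by move/(cle_leq gE); lia.
  - move=> [d [k1 [k2 [ne i1 i2 l1 l2]]]]; apply: h3; exists d, k1, k2; split=> //.
    exact: cle_trans l2 kl'.
have small m x : x < m -> part E x i -> ~ co m x -> x < b.
  move=> xm px ncx; rewrite ltnNge; apply/negP => bx; apply: ncx; apply/run_co.
  by split=> //; apply: Hb.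
have stay m : c l < m -> coc m (c l).
  elim: m => // m IH; rewrite ltnS leq_eqVlt => /orP[/eqP lm|lm].
    rewrite -lm; apply: coc_enter; first by move=> [pl _]; rewrite pl in npl.
    apply: cand; first by lia.
    move=> x; rewrite ltnS leq_eqVlt => /orP[/eqP->|]; last exact: small.
    by move=> pl; rewrite pl in npl.
  apply: coc_stay => //; first exact: IH.
  move=> ncm; apply: cand; first by lia.
  move=> x; rewrite ltnS leq_eqVlt => /orP[/eqP->|xm]; last exact: small.
  (* The set [co m] does not yet contain the new event [m]; as an [i]-event of index at least [b] it
     would be a cut-off, which this case excludes. *)
  move=> pm _; rewrite ltnNge; apply/negP => bm; exact: ncm (Hb m bm pm).
apply: (@run_noncause (c l.+1) (c l)); last by apply: cle_dep.
by right; apply: stay; apply: (chain_lt gE Hc).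
Qed.

End Termination.

Theorem theorem2 (Act : finType) (n : nat) (A : 'I_n -> LTS Act) (i : 'I_n) :
  (~ exists r : nat -> astate A,
       r 0 = ainit A /\ forall k, astep i (r k) (r k.+1)) /\
  (forall s : astate A,
     clos_refl_trans (astate A) (@astep _ _ A i) (ainit A) s ->
     terminal s ->
     bp s.1.1 /\
     forall w : word Act,
       is_trace (fstep i s.1.1 s.1.2) (fold_init i) w <->
       exists u, is_trace (@gstep _ _ A) (ginit A) u /\ proj (lsig (A i)) u w).
Proof.
split; first by move=> [r [r0 rS]]; apply: no_infinite_run r0 rS.
move=> [[P co] coc] /alg_inv_reach invP term /=; split; first by case: invP.
move=> w; split; first exact: (fold_sound invP).
by move=> [u [tu pu]]; apply: (fold_complete invP term tu pu).
Qed.
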